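(* Let $V$ be a vector space (not necessarily finite dimensional) over a field $\mathbb K$, and let $\mathrm{Hom}_V^{fr}=(\mathrm{Hom}_V^{fr}(k,l))_{k,l\ge0}$ be the family of spaces of finite rank maps defined in the context. With the symmetric group actions, the usual tensor product of maps as horizontal concatenation, and the partial trace maps given in the context, $\mathrm{Hom}_V^{fr}$ is a TRAP. It is unitary if, and only if, $V$ is finite-dimensional.
   Context: Notation: $\mathbb{N}_0=\{0,1,2,\dots\}$, $[k]=\{1,\dots,k\}$, $\mathfrak S_k$ is the symmetric group on $[k]$. TRAP. A TRAP is a family $P=(P(k,l))_{k,l\ge 0}$ of sets with: (1) for all $k,l\in\mathbb N_0$, a left action of $\mathfrak S_l$ and a right action of $\mathfrak S_k$ on $P(k,l)$ which commute (this is called an $\mathfrak S\times\mathfrak S^{op}$-module). (2) Maps $*:P(k,l)\times P(k',l')\to P(k+k',l+l')$ (horizontal concatenation) such that: $*$ is associative; there is $I_0\in P(0,0)$ with $I_0*p=p*I_0=p$; $(\sigma\cdot p\cdot\tau)*(\sigma'\cdot p'\cdot\tau')=(\sigma\otimes\sigma')\cdot(p*p')\cdot(\tau\otimes\tau')$, where for $\alpha\in\mathfrak S_m,\beta\in\mathfrak S_n$, $(\alpha\otimes\beta)(i)=\alpha(i)$ if $i\le m$ and $\beta(i-m)+m$ if $i>m$; and $c_{l,l'}\cdot(p*p')=(p'*p)\cdot c_{k,k'}$ for $p\in P(k,l)$, $p'\in P(k',l')$, where $c_{m,n}\in\mathfrak S_{m+n}$, $c_{m,n}(i)=i+n$ if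 $i\le m$ and $i-m$ if $i>m$. (3) For $k,l\ge1$, $i\in[k]$, $j\in[l]$, maps $t_{i,j}:P(k,l)\to P(k-1,l-1)$ (partial trace maps) such that: (a) for $k,l\ge2$, $i\in[k]$, $j\in[l]$, $i'\in[k-1]$, $j'\in[l-1]$: $t_{i',j'}\circ t_{i,j}$ equals $t_{i-1,j-1}\circ t_{i',j'}$ if $i'<i,j'<j$; $t_{i,j-1}\circ t_{i'+1,j'}$ if $i'\ge i,j'<j$; $t_{i-1,j}\circ t_{i',j'+1}$ if $i'<i,j'\ge j$; $t_{i,j}\circ t_{i'+1,j'+1}$ if $i'\ge i,j'\ge j$. (b) $t_{i,j}(\sigma\cdot p\cdot\tau)=\sigma_j\cdot t_{\tau(i),\sigma^{-1}(j)}(p)\cdot\tau_{\tau(i)}$, where for $\alpha\in\mathfrak S_n$ and $q\in[n]$, $\alpha_q\in\mathfrak S_{n-1}$ is the permutation whose word is obtained from the word $\alpha(1)\dots\alpha(n)$ by deleting the letter $q$ and subtracting $1$ from all letters $>q$. (c) for $p\in P(k,l)$, $p'\in P(k',l')$ ($k,l,k',l'\ge0$), $i\in[k+k']$, $j\in[l+l']$: $t_{i,j}(p*p')=t_{i,j}(p)*p'$ if $i\le k,j\le l$, and $t_{i,j}(p*p')=p*t_{i-k,j-l}(p')$ if $i>k,j>l$. The TRAP is unitary if there is $I\in P(1,1)$ such that for all $k,l\ge0$ and $p\in P(k,l)$: $t_{1,j}(I*p)=(1,2,\dots,j-1)\cdot p$ for $2\le j\le l+1$; $t_{i,1}(I*p)=p\cdot(1,2,\dots,i-1)^{-1}$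 for $2\le i\le k+1$; $t_{k+1,j}(p*I)=(j,j+1,\dots,l)^{-1}\cdot p$ for $1\le j\le l$; $t_{i,l+1}(p*I)=p\cdot(i,i+1,\dots,k)$ for $1\le i\le k$ (here $(a,\dots,b)$ denotes a cycle). The structure on $\mathrm{Hom}_V^{fr}$. $V^*$ is the algebraic dual, $V^{\otimes0}=\mathbb K$. Let $\theta_{k,l}:(V^* )^{\otimes k}\otimes V^{\otimes l}\to\mathrm{Hom}(V^{\otimes k},V^{\otimes l})$ be the injective linear map $\theta_{k,l}(f_1\dots f_k\otimes v_1\dots v_l)(x_1\dots x_k)=f_1(x_1)\cdots f_k(x_k)\,v_1\dots v_l$. $\mathrm{Hom}_V^{fr}(k,l)$ denotes the range of $\theta_{k,l}$. $\mathfrak S_k$ acts on $V^{\otimes k}$ by $\sigma\cdot v_1\otimes\dots\otimes v_k=v_{\sigma^{-1}(1)}\otimes\dots\otimes v_{\sigma^{-1}(k)}$, and for $f\in\mathrm{Hom}_V^{fr}(k,l)$, $\tau\in\mathfrak S_l$, $\sigma\in\mathfrak S_k$, $(\tau\cdot f\cdot\sigma)(w)=\tau\cdot f(\sigma\cdot w)$. Horizontal concatenation is the tensor product of linear maps, and $t_{i,j}$ is the linear map with $t_{i,j}(\theta_{k,l}(f_1\dots f_k\otimes v_1\dots v_l))=f_i(v_j)\,\theta_{k-1,l-1}(f_1\dots f_{i-1}f_{i+1}\dots f_k\otimes v_1\dots v_{j-1}v_{j+1}\dots v_l)$. *)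

(* Defs.v *)
From HB Require Import structures.
From mathcomp Require Import all_boot all_fingroup all_algebra.
From mathcomp Require Import ssralg generic_quotient ring_quotient.
From mathcomp Require Import boolp classical_sets functions.
From mathcomp.multinomials Require Import freeg.
From mathcomp Require Import fintype zify.

Set Implicit Arguments.
Unset Strict Implicit.
Unset Printing Implicit Defensive.

Import GRing.Theory.

(* Permutations of [n] are elements of 'S_n, with indices shifted down by one.
   In 'S_n the product (s * t)%g is the map i |-> t (s i), so the composite
   written s t in the usual convention is (t * s)%g here. *)
Section Permutations.

Definition tens_perm_fun m n (a : 'S_m) (b : 'S_n) (i : 'I_(m + n)) :
    'I_(m + n) :=
  match split i with inl j => lshift n (a j) | inr j => rshift m (b j) end.

Fact tens_perm_inj m n (a : 'S_m) (b : 'S_n) : injective (tens_perm_fun a b).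
Proof.
apply: (can_inj (g := tens_perm_fun a^-1%g b^-1%g)) => i.
rewrite /tens_perm_fun.
by case: (splitP i) => j ij; rewrite (unsplitK (inl _), unsplitK (inr _)) permK;
  apply: val_inj.
Qed.
Definition tens_perm m n (a : 'S_m) (b : 'S_n) : 'S_(m + n) :=
  perm (@tens_perm_inj m n a b).

Definition braid_fun m n (i : 'I_(m + n)) : 'I_(m + n) :=
  cast_ord (addnC n m)
    (match split i with inl j => rshift n j | inr j => lshift m j end).

Fact braid_inj m n : injective (@braid_fun m n).
Proof.
move=> i j /cast_ord_inj.
case: (splitP i) => a ia; case: (splitP j) => b jb /(congr1 val) /= E;
  apply: val_inj; rewrite /= ia jb //.
- exact: addnI E.
- by move: (ltn_ord b); rewrite -E ltnNge leq_addr.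
- by move: (ltn_ord a); rewrite E ltnNge leq_addr.
- by rewrite E.
Qed.
Definition braid m n : 'S_(m + n) := perm (@braid_inj m n).

(* The i-th letter of the word of s, once the letter q at position s^-1 q is
   skipped, with the letters above q lowered by one. *)
Definition del_letter_fun n (s : 'S_n.+1) (q : 'I_n.+1) (i : 'I_n) : 'I_n :=
  odflt i (unlift q (s (lift (s^-1%g q) i))).

Fact del_letter_funE n (s : 'S_n.+1) q i :
  lift q (del_letter_fun s q i) = s (lift (s^-1%g q) i).
Proof.
rewrite /del_letter_fun; case: unliftP => [j -> //|] /(congr1 s^-1%g).
by rewrite permK => /eqP; rewrite eq_sym (negPf (neq_lift _ _)).
Qed.

Fact del_letter_inj n (s : 'S_n.+1) q : injective (del_letter_fun s q).
Proof.
move=> i j /(congr1 (lift q)); rewrite !del_letter_funE => /perm_inj.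
exact: lift_inj.
Qed.
Definition del_letter n (s : 'S_n.+1) (q : 'I_n.+1) : 'S_n :=
  perm (@del_letter_inj n s q).

(* The cycle a |-> a+1 |-> ... |-> b |-> a; the identity unless a < b < n. *)
Definition cyc_fun n (a b : nat) (i : 'I_n) : 'I_n :=
  if [&& a <= i, i <= b & b < n]
  then insubd i (if i == b :> nat then a else i.+1) else i.

Fact cyc_inj n a b : injective (@cyc_fun n a b).
Proof.
have val_cyc (i : 'I_n) : val (cyc_fun a b i) =
    if [&& a <= i, i <= b & b < n]
    then (if i == b :> nat then a else i.+1) else i.
  rewrite /cyc_fun; case: ifP => // /and3P[ai ib bn].
  rewrite val_insubd ifT //; case: eqP => [_|/eqP nib].
    exact: leq_ltn_trans ai (ltn_ord i).
  by apply: leq_ltn_trans bn; rewrite ltn_neqAle nib.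
move=> i j /(congr1 val); rewrite !val_cyc => E; apply: val_inj; move: E => /=.
move: (nat_of_ord i) (nat_of_ord j) => x y.
by case: and3P => [[]|ny]; case: and3P => [[]|nx]; do ?[case: eqP];
  move=> *; solve [lia | case: nx; split; lia | case: ny; split; lia].
Qed.
Definition cyc n a b : 'S_n := perm (@cyc_inj n a b).

End Permutations.

(* trap_sort k l is the set P(k, l); ptrace is defined on P(k + 1, l + 1), so
   that the conditions k >= 1 and l >= 1 are built in. *)
Record trap_data := TrapData {
  trap_sort :> nat -> nat -> Type;
  lact : forall k l, 'S_l -> trap_sort k l -> trap_sort k l;
  ract : forall k l, trap_sort k l -> 'S_k -> trap_sort k l;
  hcat : forall k l k' l', trap_sort k l -> trap_sort k' l' ->
           trap_sort (k + k') (l + l');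
  ptrace : forall k l, 'I_k.+1 -> 'I_l.+1 ->
             trap_sort k.+1 l.+1 -> trap_sort k l
}.

(* Transport along equalities such as k + 0 = k, which do not hold by
   computation. *)
Definition recast (P : trap_data) k k' l l' (ek : k = k') (el : l = l')
    (p : P k l) : P k' l' :=
  let: erefl := ek in let: erefl := el in p.

Record is_trap (P : trap_data) : Prop := IsTrap {
  lact1 : forall k l (p : P k l), lact 1%g p = p;
  lactM : forall k l (s t : 'S_l) (p : P k l),
    lact (t * s)%g p = lact s (lact t p);
  ract1 : forall k l (p : P k l), ract p 1%g = p;
  ractM : forall k l (s t : 'S_k) (p : P k l),
    ract p (t * s)%g = ract (ract p s) t;
  lractA : forall k l (s : 'S_l) (t : 'S_k) (p : P k l),
    ract (lact s p) t = lact s (ract p t);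

  hcatA : forall k l k' l' k'' l'' (p : P k l) (p' : P k' l') (p'' : P k'' l''),
    recast (addnA k k' k'') (addnA l l' l'') (hcat p (hcat p' p'')) =
    hcat (hcat p p') p'';
  hcat_unit : exists I0 : P 0 0, forall k l (p : P k l),
    hcat I0 p = p /\ recast (addn0 k) (addn0 l) (hcat p I0) = p;
  hcat_act : forall k l k' l' (s : 'S_l) (t : 'S_k) (s' : 'S_l') (t' : 'S_k')
      (p : P k l) (p' : P k' l'),
    hcat (ract (lact s p) t) (ract (lact s' p') t') =
    ract (lact (tens_perm s s') (hcat p p')) (tens_perm t t');
  hcatC : forall k l k' l' (p : P k l) (p' : P k' l'),
    lact (braid l l') (hcat p p') =
    ract (recast (addnC k' k) (addnC l' l) (hcat p' p)) (braid k k');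

  (* inord moves an index to the ordinal type of the other trace; its argument
     is within bounds in each of the four cases. *)
  ptraceC : forall k l (p : P k.+2 l.+2) (i : 'I_k.+2) (j : 'I_l.+2)
      (i' : 'I_k.+1) (j' : 'I_l.+1),
    [/\ i' < i -> j' < j ->
          ptrace i' j' (ptrace i j p) =
          ptrace (inord i.-1) (inord j.-1) (ptrace (inord i') (inord j') p),
        i <= i' -> j' < j ->
          ptrace i' j' (ptrace i j p) =
          ptrace (inord i) (inord j.-1) (ptrace (inord i'.+1) (inord j') p),
        i' < i -> j <= j' ->
          ptrace i' j' (ptrace i j p) =
          ptrace (inord i.-1) (inord j) (ptrace (inord i') (inord j'.+1) p) &
        i <= i' -> j <= j' ->
          ptrace i' j' (ptrace i j p) =
          ptrace (inord i) (inord j) (ptrace (inord i'.+1) (inord j'.+1) p)];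
  ptrace_act : forall k l (p : P k.+1 l.+1) (s : 'S_l.+1) (t : 'S_k.+1)
      (i : 'I_k.+1) (j : 'I_l.+1),
    ptrace i j (ract (lact s p) t) =
    ract (lact (del_letter s j) (ptrace (t i) (s^-1%g j) p))
         (del_letter t (t i));
  ptrace_hcatl : forall k l k' l' (p : P k.+1 l.+1) (p' : P k' l')
      (i : 'I_k.+1) (j : 'I_l.+1),
    ptrace (lshift k' i : 'I_(k + k').+1) (lshift l' j : 'I_(l + l').+1)
      (hcat p p' : P (k + k').+1 (l + l').+1) =
    hcat (ptrace i j p) p';
  ptrace_hcatr : forall k l k' l' (p : P k l) (p' : P k'.+1 l'.+1)
      (i : 'I_k'.+1) (j : 'I_l'.+1),
    ptrace (cast_ord (addnS k k') (rshift k i))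
           (cast_ord (addnS l l') (rshift l j))
           (recast (addnS k k') (addnS l l') (hcat p p')) =
    hcat p (ptrace i j p')
}.

Definition unitary (P : trap_data) : Prop :=
  exists I : P 1 1, forall k l (p : P k l),
    [/\ forall j : 'I_l.+1, 0 < j ->
          ptrace ord0 j (hcat I p : P k.+1 l.+1) = lact (cyc l 0 j.-1) p,
        forall i : 'I_k.+1, 0 < i ->
          ptrace i ord0 (hcat I p : P k.+1 l.+1) = ract p (cyc k 0 i.-1)^-1%g,
        forall j : 'I_l.+1, j < l ->
          ptrace ord_max j (recast (addn1 k) (addn1 l) (hcat p I)) =
          lact (cyc l j l.-1)^-1%g p &
        forall i : 'I_k.+1, i < k ->
          ptrace i ord_max (recast (addn1 k) (addn1 l) (hcat p I)) =
          ract p (cyc k i k.-1)].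

Local Open Scope ring_scope.
Local Open Scope quotient_scope.

(* Hom(U, W) is the library's type of linear maps, given here its pointwise
   vector space structure. *)
Section LinearMaps.
Variables (K : fieldType) (U W : lmodType K).
Implicit Types f g h : {linear U -> W}.

Lemma linear_ext f g : f =1 g -> f = g.
Proof.
move=> fg; have {}fg : (f : U -> W) = g by apply/funext.
case: f g fg => f [[fD] [fZ]] [g [[gD] [gZ]]] /= fg.
case: _ / fg in gD gZ *.
by rewrite (Prop_irrelevance fD gD) (Prop_irrelevance fZ gZ).
Qed.

HB.instance Definition _ := gen_eqMixin {linear U -> W}.
HB.instance Definition _ := gen_choiceMixin {linear U -> W}.

Definition lin0 : {linear U -> W} := \0.
Definition linD f g : {linear U -> W} := f \+ g.
Definition linN f : {linear U -> W} := \- f.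
Definition linZ a f : {linear U -> W} := a \*: f.

Fact linDA : associative linD.
Proof. by move=> f g h; apply: linear_ext => x /=; rewrite addrA. Qed.
Fact linDC : commutative linD.
Proof. by move=> f g; apply: linear_ext => x /=; rewrite addrC. Qed.
Fact lin0D : left_id lin0 linD.
Proof. by move=> f; apply: linear_ext => x /=; rewrite add0r. Qed.
Fact linND : left_inverse lin0 linN linD.
Proof. by move=> f; apply: linear_ext => x /=; rewrite addNr. Qed.
HB.instance Definition _ :=
  GRing.isZmodule.Build {linear U -> W} linDA linDC lin0D linND.

Fact linZA a b f : linZ a (linZ b f) = linZ (a * b) f.
Proof. by apply: linear_ext => x /=; rewrite scalerA. Qed.
Fact lin1Z : left_id 1 linZ.
Proof. by move=> f; apply: linear_ext => x /=; rewrite scale1r. Qed.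
Fact linZDr : right_distributive linZ +%R.
Proof. by move=> a f g; apply: linear_ext => x /=; rewrite scalerDr. Qed.
Fact linZDl f : {morph linZ^~ f : a b / a + b}.
Proof. by move=> a b; apply: linear_ext => x /=; rewrite scalerDl. Qed.
HB.instance Definition _ :=
  GRing.Zmodule_isLmodule.Build K {linear U -> W} linZA lin1Z linZDr linZDl.

Definition mklin (f : U -> W) (lin_f : linear f) : {linear U -> W} :=
  HB.pack f (GRing.isLinear.Build K U W *:%R f lin_f).

Lemma lin0E x : (0 : {linear U -> W}) x = 0. Proof. by []. Qed.
Lemma lincE a f g x : (a *: f + g) x = a *: f x + g x. Proof. by []. Qed.

End LinearMaps.

(* The vector space with generators X and relations R: the quotient of the
   free module on X by the smallest subspace containing R. *)
Section Presentation.
Variables (K : fieldType) (X : choiceType) (R : set {freeg X / K}).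

Definition relspan (x : {freeg X / K}) : bool :=
  `[< forall S : set {freeg X / K},
        S 0 -> (forall a u v, S u -> S v -> S (a *: u + v)) ->
        (R `<=` S)%classic -> S x >].

Fact relspan_submod : submod_closed relspan.
Proof.
split=> [|a u v /asboolP uR /asboolP vR]; apply/asboolP => // S S0 SD RS.
by apply: (SD); [apply: uR | apply: vR].
Qed.
HB.instance Definition _ := GRing.isZmodClosed.Build {freeg X / K} relspan
  (GRing.submod_closedB relspan_submod).
HB.instance Definition _ := GRing.isScaleClosed.Build K {freeg X / K} relspan
  (GRing.submod_closed_semi relspan_submod).2.

Lemma relspan_incl r : R r -> r \in relspan.
Proof. by move=> Rr; apply/asboolP => S S0 SD; apply. Qed.

Definition pres :=
  Quotient.quot (GRing.ZmodClosed.clone {freeg X / K} relspan _).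
HB.instance Definition _ := GRing.Zmodule.on pres.
HB.instance Definition _ := ZmodQuotient.on pres.

Definition pres_scale a (q : pres) : pres := \pi_pres (a *: repr q).

Fact pi_scale a x : pres_scale a (\pi_pres x) = \pi_pres (a *: x).
Proof.
apply/eqP; rewrite -Quotient.idealrBE -scalerBr rpredZ //.
by rewrite Quotient.idealrBE reprK.
Qed.

Fact pres_scaleA a b q : pres_scale a (pres_scale b q) = pres_scale (a * b) q.
Proof.
elim/quotW: q => x.
by rewrite (pi_scale b x) (pi_scale a (b *: x)) (pi_scale (a * b) x) scalerA.
Qed.
Fact pres_scale1 : left_id 1 pres_scale.
Proof. by elim/quotW => x; rewrite (pi_scale 1 x) scale1r. Qed.
Fact pres_scaleDr : right_distributive pres_scale +%R.
Proof.
move=> a; elim/quotW => x; elim/quotW => y.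
rewrite -raddfD (pi_scale a (x + y)) (pi_scale a x) (pi_scale a y).
by rewrite scalerDr raddfD.
Qed.
Fact pres_scaleDl q : {morph pres_scale^~ q : a b / a + b}.
Proof.
elim/quotW: q => x a b.
by rewrite (pi_scale (a + b) x) (pi_scale a x) (pi_scale b x) scalerDl raddfD.
Qed.
HB.instance Definition _ := GRing.Zmodule_isLmodule.Build K pres
  pres_scaleA pres_scale1 pres_scaleDr pres_scaleDl.

Definition gen (x : X) : pres := \pi_pres << x >>.

(* A map on the generators that kills the relations extends linearly. *)
Section Lift.
Variables (U : lmodType K) (phi : X -> U).

Fact fglift_linear : linear (fglift phi).
Proof.
have liftB := lift_is_additive phi.
have lift0 : fglift phi 0 = 0 by rewrite -(subrr 0) liftB subrr.
have liftD u v : fglift phi (u + v) = fglift phi u + fglift phi v.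
  have /(canRL (subrK _)) E := esym (liftB (u + v) v).
  by rewrite E addrK.
have lift_sum I (r : seq I) (F : I -> {freeg X / K}) :
    fglift phi (\sum_(i <- r) F i) = \sum_(i <- r) fglift phi (F i).
  by elim/big_rec2: _ => // i u v _ <-; rewrite liftD.
move=> a u v; rewrite liftD; congr (_ + _).
rewrite -[in RHS](freeg_sumE u) lift_sum scaler_sumr [LHS]lift_sum.
by apply: eq_bigr => x _; rewrite !liftU scalerA.
Qed.

Hypothesis phiR : forall r, R r -> fglift phi r = 0.

Fact fglift_relspan x : x \in relspan -> fglift phi x = 0.
Proof.
have lift0 : fglift phi 0 = 0 by apply: (raddf0 (mklin fglift_linear)).
move/asboolP => /(_ [set y | fglift phi y = 0])%classic; apply => //=.
by move=> a u v u0 v0; rewrite fglift_linear u0 v0 scaler0 addr0.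
Qed.

Fact pres_lift_pi x : fglift phi (repr (\pi_pres x)) = fglift phi x.
Proof.
apply/eqP; rewrite -subr_eq0 -(raddfB (mklin fglift_linear)) /=; apply/eqP.
by apply: fglift_relspan; rewrite Quotient.idealrBE reprK.
Qed.

Fact pres_lift_linear : linear (fun q : pres => fglift phi (repr q)).
Proof.
move=> a; elim/quotW => u; elim/quotW => v.
have -> : a *: \pi_pres u = \pi_pres (a *: u) by exact: (pi_scale a u).
by rewrite -raddfD !pres_lift_pi fglift_linear.
Qed.
Definition pres_lift : {linear pres -> U} := locked (mklin pres_lift_linear).

Lemma pres_liftE x : pres_lift (gen x) = phi x.
Proof. by rewrite /pres_lift -lock /= pres_lift_pi liftU scale1r. Qed.
End Lift.

Lemma pres_ind (P : pres -> Prop) :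
  P 0 -> (forall a u v, P u -> P v -> P (a *: u + v)) ->
  (forall x, P (gen x)) -> forall q, P q.
Proof.
move=> P0 PD Pgen; elim/quotW => u; rewrite -(freeg_sumE u) raddf_sum /=.
elim/big_rec: _ => // x q _ Pq.
suff -> : \pi_pres << coeff x u *g x >> = coeff x u *: gen x by apply: PD.
rewrite [RHS](pi_scale _ << x >>); congr (\pi_pres _).
by apply/eqP/freeg_eqP => y; rewrite coeffZ !coeffU mul1r.
Qed.

Lemma pres_ext (U : lmodType K) (f g : {linear pres -> U}) :
  (forall x, f (gen x) = g (gen x)) -> f = g.
Proof.
move=> fg; apply: linear_ext; apply: pres_ind => //; first by rewrite !raddf0.
by move=> a u v fu fv; rewrite !linearP fu fv.
Qed.

Lemma gen_rel (x y z : X) a :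
  R (<< x >> - (a *: << y >> + << z >>)) ->
  gen x = a *: gen y + gen z.
Proof.
move=> /relspan_incl; rewrite Quotient.idealrBE => /eqP E.
by rewrite /gen E raddfD; congr (_ + _); rewrite [RHS](pi_scale a << y >>).
Qed.

Lemma fglift_rel (U : lmodType K) (phi : X -> U) (x y z : X) a :
  phi x = a *: phi y + phi z ->
  fglift phi (<< x >> - (a *: << y >> + << z >>)) = 0.
Proof.
move=> E; have F := raddfB (mklin (fglift_linear phi)); rewrite /= in F.
by rewrite F fglift_linear !liftU !scale1r E subrr.
Qed.
End Presentation.
Arguments gen {K X} R x.
Arguments pres_lift {K X R U phi} phiR.

Section Tensor.
Variable K : fieldType.
Implicit Types A B U V W : lmodType K.

Definition bilinear_rel A B : set {freeg (A * B)%type / K} := [set r |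
  (exists a x x' y,
     r = << (a *: x + x', y) >> - (a *: << (x, y) >> + << (x', y) >>)) \/
  (exists a x y y',
     r = << (x, a *: y + y') >> - (a *: << (x, y) >> + << (x, y') >>))]%classic.

Definition tens A B : lmodType K := pres (@bilinear_rel A B).
Definition tpair A B (x : A) (y : B) : tens A B := gen _ (x, y).

Definition upd V k (w : 'I_k -> V) (i : 'I_k) (x : V) : 'I_k -> V :=
  fun j => if j == i then x else w j.

Definition multilinear V k U (phi : ('I_k -> V) -> U) :=
  forall w i, linear (fun x => phi (upd w i x)).

Definition multilinear_rel V k : set {freeg ('I_k -> V) / K} := [set r |
  exists w i a x y, r = << upd w i (a *: x + y) >>
                        - (a *: << upd w i x >> + << upd w i y >>)]%classic.

(* For k = 0 there are no relations and a single generator, so that the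
   tensor power is the free module K on that generator. *)
Definition tpow V k : lmodType K := pres (@multilinear_rel V k).
Definition ptens V k (w : 'I_k -> V) : tpow V k := gen _ w.

Lemma tpair_linearl A B (y : B) : linear (fun x : A => tpair x y).
Proof. by move=> a x x'; apply: gen_rel; left; exists a, x, x', y. Qed.

Lemma tpair_linearr A B (x : A) : linear (fun y : B => tpair x y).
Proof. by move=> a y y'; apply: gen_rel; right; exists a, x, y, y'. Qed.

Lemma ptens_multilinear V k : multilinear (@ptens V k).
Proof. by move=> w i a x y; apply: gen_rel; exists w, i, a, x, y. Qed.

Section TensLift.
Variables (A B U : lmodType K) (phi : A -> B -> U).
Hypothesis phil : forall y, linear (phi^~ y).
Hypothesis phir : forall x, linear (phi x).

Fact tens_lift_subproof r :
  bilinear_rel r -> fglift (fun p => phi p.1 p.2) r = 0.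
Proof.
move=> [] [a [x [y [z ->]]]]; apply: fglift_rel => /=.
  exact: phil.
exact: phir.
Qed.
Definition tens_lift : {linear tens A B -> U} := pres_lift tens_lift_subproof.

Lemma tens_liftE x y : tens_lift (tpair x y) = phi x y.
Proof. exact: pres_liftE. Qed.
End TensLift.

Section TpowLift.
Variables (V U : lmodType K) (k : nat) (phi : ('I_k -> V) -> U).
Hypothesis phi_ml : multilinear phi.

Fact tpow_lift_subproof r : multilinear_rel r -> fglift phi r = 0.
Proof. by move=> [w [i [a [x [y ->]]]]]; apply: fglift_rel; apply: phi_ml. Qed.
Definition tpow_lift : {linear tpow V k -> U} := pres_lift tpow_lift_subproof.

Lemma tpow_liftE w : tpow_lift (ptens w) = phi w.
Proof. exact: pres_liftE. Qed.
End TpowLift.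

Lemma tpow_ind V k (P : tpow V k -> Prop) :
  P 0 -> (forall a u v, P u -> P v -> P (a *: u + v)) ->
  (forall w, P (ptens w)) -> forall t, P t.
Proof. exact: pres_ind. Qed.

Lemma tpow_ext V k U (f g : {linear tpow V k -> U}) :
  (forall w, f (ptens w) = g (ptens w)) -> f = g.
Proof. exact: pres_ext. Qed.

Lemma tens_ind A B k l (P : tens (tpow A k) (tpow B l) -> Prop) :
  P 0 -> (forall a u v, P u -> P v -> P (a *: u + v)) ->
  (forall f v, P (tpair (ptens f) (ptens v))) -> forall t, P t.
Proof.
move=> P0 PD Pp; apply: pres_ind => // -[x y]; rewrite -/(tpair x y).
elim/tpow_ind: x => [|a u v Pu Pv|f].
- suff -> : tpair (0 : tpow A k) y = 0 by [].
  exact: (raddf0 (mklin (tpair_linearl y))).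
- by rewrite tpair_linearl; apply: PD.
elim/tpow_ind: y => [|a u v Pu Pv|v] //.
- suff -> : tpair (ptens f) (0 : tpow B l) = 0 by [].
  exact: (raddf0 (mklin (tpair_linearr (ptens f)))).
- by rewrite tpair_linearr; apply: PD.
Qed.

Lemma tens_ext A B k l U (F G : {linear tens (tpow A k) (tpow B l) -> U}) :
  (forall f v, F (tpair (ptens f) (ptens v)) = G (tpair (ptens f) (ptens v))) ->
  F = G.
Proof.
move=> FG; apply: linear_ext; apply: tens_ind => //; first by rewrite !raddf0.
by move=> a u v Fu Fv; rewrite !linearP Fu Fv.
Qed.

(* A map that is multilinear in two groups of variables extends linearly to
   the tensor product of two tensor powers. *)
Section Lift2.
Variables (A B U : lmodType K) (k l : nat).
Variable phi : ('I_k -> A) -> ('I_l -> B) -> U.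
Hypothesis phil : forall v, multilinear (phi^~ v).
Hypothesis phir : forall f, multilinear (phi f).

Fact lift2_subproof : multilinear (fun f => tpow_lift (phir f)).
Proof.
move=> f i a x y; apply: tpow_ext => v.
by rewrite lincE !tpow_liftE; apply: phil.
Qed.
Definition lift2_fun (x : tpow A k) : {linear tpow B l -> U} :=
  tpow_lift lift2_subproof x.

Fact lift2_linearl y : linear (fun x => lift2_fun x y).
Proof. by move=> a x x'; rewrite /lift2_fun linearP. Qed.
Fact lift2_linearr x : linear (lift2_fun x).
Proof. exact: linearP. Qed.
Definition lift2 : {linear tens (tpow A k) (tpow B l) -> U} :=
  tens_lift lift2_linearl lift2_linearr.

Lemma lift2E f v : lift2 (tpair (ptens f) (ptens v)) = phi f v.
Proof. by rewrite tens_liftE /lift2_fun !tpow_liftE. Qed.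
End Lift2.

Definition dual V : lmodType K := {linear V -> K^o}.

Section Theta.
Variables (V : lmodType K) (k l : nat).

Fact prod_upd T k' (F : 'I_k' -> T -> K) (w : 'I_k' -> T) i x :
  \prod_j F j (if j == i then x else w j) =
  F i x * \prod_(j | j != i) F j (w j).
Proof.
rewrite (bigD1 i) //= eqxx; congr (_ * _).
by apply: eq_bigr => j /negPf ->.
Qed.

Definition theta_pure (f : 'I_k -> dual V) (v : 'I_l -> V) (x : 'I_k -> V) :
  tpow V l := (\prod_i f i (x i)) *: ptens v.

Fact theta_pure_ml f v : multilinear (theta_pure f v).
Proof.
move=> w i a x y; rewrite /theta_pure scalerA -scalerDl; congr (_ *: _).
have E z := prod_upd (fun j (u : V) => f j u) w i z.
by rewrite /upd !E linearP mulrDl mulrA.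
Qed.

Fact theta_pure_mlr f : multilinear (fun v => tpow_lift (theta_pure_ml f v)).
Proof.
move=> v i a x y; apply: tpow_ext => w; rewrite lincE !tpow_liftE /theta_pure.
by rewrite ptens_multilinear scalerDr !scalerA mulrC.
Qed.

Fact theta_pure_mll v : multilinear (fun f => tpow_lift (theta_pure_ml f v)).
Proof.
move=> f i a x y; apply: tpow_ext => w; rewrite lincE !tpow_liftE /theta_pure.
rewrite scalerA -scalerDl; congr (_ *: _).
have E g := prod_upd (fun j (h : dual V) => h (w j)) f i g.
by rewrite /upd !E lincE mulrDl mulrA.
Qed.

Definition theta :
    {linear tens (tpow (dual V) k) (tpow V l) ->
            {linear tpow V k -> tpow V l}} :=
  lift2 theta_pure_mll theta_pure_mlr.

Lemma thetaE f v x :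
  theta (tpair (ptens f) (ptens v)) (ptens x) = (\prod_i f i (x i)) *: ptens v.
Proof. by rewrite lift2E tpow_liftE. Qed.

End Theta.

Definition homfr V k l := set_type (range (@theta V k l)).

Fact mem_range_theta V k l (f : {linear tpow V k -> tpow V l}) :
  (exists t, theta V k l t = f) -> f \in range (theta V k l).
Proof. by move=> [t <-]; apply: mem_set; exists t. Qed.

Definition mk_homfr V k l (f : {linear tpow V k -> tpow V l})
  (fP : exists t, theta V k l t = f) : homfr V k l :=
  SigSub (mem_range_theta fP).

Fact homfr_preimage V k l (p : homfr V k l) : exists t, theta V k l t = val p.
Proof. by case: (set_valP p) => t _ <-; exists t. Qed.

(* The map theta is injective, so the chosen preimage is the only one. *)
Definition theta_inv V k l (p : homfr V k l) :
  tens (tpow (dual V) k) (tpow V l) := sval (cid (homfr_preimage p)).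

Section Actions.
Variable V : lmodType K.

Fact tact_ml k (s : 'S_k) :
  multilinear (fun w => ptens (w \o s^-1%g) : tpow V k).
Proof.
move=> w i a x y.
have E z : upd w i z \o s^-1%g = upd (w \o s^-1%g) (s i) z.
  by apply/funext => j; rewrite /= /upd (can2_eq (permKV s) (permK s)).
by rewrite !E ptens_multilinear.
Qed.
Definition tact k (s : 'S_k) : {linear tpow V k -> tpow V k} :=
  tpow_lift (tact_ml s).

Lemma tactE k (s : 'S_k) w : tact s (ptens w) = ptens (w \o s^-1%g).
Proof. exact: tpow_liftE. Qed.

Fact lact_subproof k l (s : 'S_l) (p : homfr V k l) :
  exists t, theta V k l t = tact s \o val p.
Proof.
have [t <-] := homfr_preimage p; elim/tens_ind: t => [|a u v|f v].
- exists 0; apply: linear_ext => x; rewrite !raddf0.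
  exact: esym (raddf0 (tact s)).
- move=> [u' Eu] [v' Ev]; exists (a *: u' + v'); apply: linear_ext => x.
  rewrite linearP lincE Eu Ev -[RHS]/(tact s (theta V k l (a *: u + v) x)).
  by rewrite linearP lincE linearP.
exists (tpair (ptens f) (ptens (v \o s^-1%g))); apply: tpow_ext => x.
rewrite thetaE -[RHS]/(tact s (theta V k l _ (ptens x))) thetaE.
by rewrite linearZZ tactE.
Qed.
Definition homfr_lact k l (s : 'S_l) (p : homfr V k l) : homfr V k l :=
  mk_homfr (lact_subproof s p).

Fact ract_subproof k l (s : 'S_k) (p : homfr V k l) :
  exists t, theta V k l t = val p \o tact s.
Proof.
have [t <-] := homfr_preimage p; elim/tens_ind: t => [|a u v|f v].
- by exists 0; apply: linear_ext => x; rewrite !raddf0.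
- move=> [u' Eu] [v' Ev]; exists (a *: u' + v'); apply: linear_ext => x.
  by rewrite linearP lincE Eu Ev -[RHS]/(theta V k l (a *: u + v) (tact s x))
             linearP lincE.
exists (tpair (ptens (f \o s)) (ptens v)); apply: tpow_ext => x.
rewrite -[RHS]/(theta V k l _ (tact s (ptens x))) tactE !thetaE; congr (_ *: _).
rewrite [RHS](reindex_inj (@perm_inj _ s)).
by apply: eq_bigr => i _; rewrite /= permK.
Qed.
Definition homfr_ract k l (p : homfr V k l) (s : 'S_k) : homfr V k l :=
  mk_homfr (ract_subproof s p).
End Actions.

Section Concatenation.
Variable V : lmodType K.

Definition catf T m n (w : 'I_m -> T) (w' : 'I_n -> T) (i : 'I_(m + n)) : T :=
  match split i with inl j => w j | inr j => w' j end.

Fact catf_upd_l m n (w : 'I_m -> V) (w' : 'I_n -> V) i x :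
  catf (upd w i x) w' = upd (catf w w') (lshift n i) x.
Proof.
apply/funext => j; rewrite /catf /upd -[j]splitK.
by case: (split j) => a; rewrite unsplitK /= ?eq_lshift ?eq_rlshift.
Qed.

Fact catf_upd_r m n (w : 'I_m -> V) (w' : 'I_n -> V) i x :
  catf w (upd w' i x) = upd (catf w w') (rshift m i) x.
Proof.
apply/funext => j; rewrite /catf /upd -[j]splitK.
by case: (split j) => a; rewrite unsplitK /= ?eq_rshift ?eq_lrshift.
Qed.

Fact tcat_mlr m n (w : 'I_m -> V) :
  multilinear (fun w' : 'I_n -> V => ptens (catf w w')).
Proof. by move=> w' i a x y; rewrite !catf_upd_r ptens_multilinear. Qed.

Fact tcat_mll m n :
  multilinear (fun w : 'I_m -> V => tpow_lift (@tcat_mlr m n w)).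
Proof.
move=> w i a x y; apply: tpow_ext => w'; rewrite lincE !tpow_liftE.
by rewrite !catf_upd_l ptens_multilinear.
Qed.

(* The canonical identification of the tensor product of the m-th and n-th
   tensor powers of V with the (m + n)-th one, as a bilinear map. *)
Definition tcat m n :
    {linear tpow V m -> {linear tpow V n -> tpow V (m + n)}} :=
  tpow_lift (@tcat_mll m n).

Lemma tcatE m n (w : 'I_m -> V) (w' : 'I_n -> V) :
  tcat m n (ptens w) (ptens w') = ptens (catf w w').
Proof. by rewrite !tpow_liftE. Qed.

Lemma tcatZ m n a b (x : tpow V m) (y : tpow V n) :
  tcat m n (a *: x) (b *: y) = (a * b) *: tcat m n x y.
Proof.
have -> : tcat m n (a *: x) = a *: tcat m n x by exact: linearZZ.
have -> : (a *: tcat m n x) (b *: y) = a *: tcat m n x (b *: y) by [].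
by rewrite -scalerA; congr (_ *: _); exact: linearZZ.
Qed.

Section TensorMap.
Variables (k l k' l' : nat).
Variable f : {linear tpow V k -> tpow V l}.
Variable g : {linear tpow V k' -> tpow V l'}.

Fact tmap_ml : multilinear (fun w : 'I_(k + k') -> V =>
  tcat l l' (f (ptens (w \o lshift k'))) (g (ptens (w \o @rshift k k')))).
Proof.
move=> w i a x y; rewrite -[i]splitK; case: (split i) => j /=.
- have El z : upd w (lshift k' j) z \o lshift k' = upd (w \o lshift k') j z.
    by apply/funext => b; rewrite /= /upd eq_lshift.
  have Er z : upd w (lshift k' j) z \o @rshift k k' = w \o @rshift k k'.
    by apply/funext => b; rewrite /= /upd eq_rlshift.
  by rewrite !El !Er ptens_multilinear !linearP lincE.
- have El z : upd w (rshift k j) z \o lshift k' = w \o lshift k'.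
    by apply/funext => b; rewrite /= /upd eq_lrshift.
  have Er z :
      upd w (rshift k j) z \o @rshift k k' = upd (w \o @rshift k k') j z.
    by apply/funext => b; rewrite /= /upd eq_rshift.
  by rewrite !El !Er ptens_multilinear !linearP.
Qed.
Definition tmap : {linear tpow V (k + k') -> tpow V (l + l')} :=
  tpow_lift tmap_ml.

Lemma tmapE x y : tmap (tcat k k' x y) = tcat l l' (f x) (g y).
Proof.
elim/tpow_ind: x => [|a u v Eu Ev|w]; first by rewrite !raddf0.
  by rewrite !(linearP, lincE) Eu Ev.
elim/tpow_ind: y => [|a u v Eu Ev|w']; first by rewrite !raddf0.
  by rewrite !linearP Eu Ev.
rewrite tcatE tpow_liftE; congr (tcat _ _ (f (ptens _)) (g (ptens _)));
  apply/funext => i; rewrite /= /catf.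
  by rewrite -[lshift _ _]/(unsplit (inl _)) unsplitK.
by rewrite -[rshift _ _]/(unsplit (inr _)) unsplitK.
Qed.
End TensorMap.

Lemma tcat_ext U m n (F G : {linear tpow V (m + n) -> U}) :
  (forall w w', F (tcat m n (ptens w) (ptens w')) =
                G (tcat m n (ptens w) (ptens w'))) -> F = G.
Proof.
move=> FG; apply: tpow_ext => w.
have -> : w = catf (w \o lshift n) (w \o @rshift m n); last first.
  by rewrite -tcatE FG.
by apply/funext => i; rewrite /catf -[in LHS](splitK i); case: (split i).
Qed.

Fact hcat_subproof k l k' l' (p : homfr V k l) (p' : homfr V k' l') :
  exists t, theta V (k + k') (l + l') t = tmap (val p) (val p').
Proof.
have [x <-] := homfr_preimage p; have [y <-] := homfr_preimage p'.
elim/tens_ind: x => [|a u v|f v].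
- exists 0; apply: tcat_ext => w w'.
  by rewrite tmapE !(raddf0, lin0E).
- move=> [u' Eu] [v' Ev]; exists (a *: u' + v'); apply: tcat_ext => w w'.
  by rewrite !(linearP, lincE) Eu Ev !tmapE !(linearP, lincE).
elim/tens_ind: y => [|a u' v'|f' v'].
- exists 0; apply: tcat_ext => w w'.
  by rewrite tmapE !(raddf0, lin0E).
- move=> [u1 Eu] [v1 Ev]; exists (a *: u1 + v1); apply: tcat_ext => w w'.
  by rewrite !(linearP, lincE) Eu Ev !tmapE !(linearP, lincE).
exists (tpair (ptens (catf f f')) (ptens (catf v v'))).
apply: tcat_ext => w w'; rewrite tmapE !tcatE !thetaE tcatZ tcatE.
congr (_ *: _); rewrite big_split_ord /=; congr (_ * _); apply: eq_bigr => i _.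
  by rewrite /catf -[lshift _ _]/(unsplit (inl _)) unsplitK.
by rewrite /catf -[rshift _ _]/(unsplit (inr _)) unsplitK.
Qed.
Definition homfr_hcat k l k' l' (p : homfr V k l) (p' : homfr V k' l') :
  homfr V (k + k') (l + l') := mk_homfr (hcat_subproof p p').
End Concatenation.

Section Trace.
Variables (V : lmodType K) (k l : nat) (i : 'I_k.+1) (j : 'I_l.+1).

Definition contract (f : 'I_k.+1 -> dual V) (v : 'I_l.+1 -> V) :
    tens (tpow (dual V) k) (tpow V l) :=
  (f i (v j) : K) *: tpair (ptens (f \o lift i)) (ptens (v \o lift j)).

Fact upd_lift A n (w : 'I_n.+1 -> A) (a b : 'I_n.+1) x :
  upd w b x \o lift a =
  if unlift a b is Some c then upd (w \o lift a) c x else w \o lift a.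
Proof.
apply/funext => c; rewrite /= /upd; case: unliftP => [d ->|->].
  by rewrite (inj_eq (@lift_inj _ a)).
by rewrite eq_sym (negPf (neq_lift _ _)).
Qed.

Fact contract_mll v : multilinear (contract^~ v).
Proof.
move=> f b a x y; rewrite /contract !upd_lift.
case: (unliftP i b) => [c ->|->]; rewrite /upd.
  rewrite (negPf (neq_lift _ _)) -/(upd _ _ _) ptens_multilinear tpair_linearl.
  by rewrite scalerDr !scalerA mulrC.
by rewrite eqxx lincE scalerDl scalerA.
Qed.

Fact contract_mlr f : multilinear (contract f).
Proof.
move=> v b a x y; rewrite /contract !upd_lift.
case: (unliftP j b) => [c ->|->]; rewrite /upd.
  rewrite (negPf (neq_lift _ _)) -/(upd _ _ _) ptens_multilinear tpair_linearr.
  by rewrite scalerDr !scalerA mulrC.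
by rewrite eqxx linearP scalerDl scalerA.
Qed.

(* Contraction of the i-th linear form with the j-th vector. *)
Definition ttrace :
    {linear tens (tpow (dual V) k.+1) (tpow V l.+1) ->
            tens (tpow (dual V) k) (tpow V l)} :=
  lift2 contract_mll contract_mlr.

Lemma ttraceE f v :
  ttrace (tpair (ptens f) (ptens v)) =
  (f i (v j) : K) *: tpair (ptens (f \o lift i)) (ptens (v \o lift j)).
Proof. exact: lift2E. Qed.

Definition homfr_ptrace (p : homfr V k.+1 l.+1) : homfr V k l :=
  mk_homfr (ex_intro _ (ttrace (theta_inv p)) erefl).
End Trace.

Definition homfr_trap V : trap_data :=
  @TrapData (homfr V) (@homfr_lact V) (@homfr_ract V) (@homfr_hcat V)
    (fun k l => @homfr_ptrace V k l).

End Tensor.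

Definition finite_dimensional (K : fieldType) (V : lmodType K) : Prop :=
  exists n, inhabited (Vector.axiom n V).

(* Main.v *)
Require Import Defs.
From HB Require Import structures.
From mathcomp Require Import all_boot all_fingroup all_algebra.
From mathcomp Require Import boolp classical_sets zify.

(**
The maps [theta (f_1 ... f_k (x) v_1 ... v_l)], called pure below, span
[Hom_V^fr(k, l)].  The actions and the concatenation are linear in each
argument and permute or juxtapose the lists [f] and [v] of a pure map; once the
partial traces are known to be linear too, every TRAP axiom is an identity
between reindexed lists on pure maps, checked position by position
([lift_swap_lt], [lift_del_letter], [catf_braid] and their neighbours).

The point that is not formal is that the partial trace of a map [theta t] does
not depend on the tensor [t].  The forms occurring in [t] span a
finite-dimensional space of forms, and elimination gives vectors [y_c] and forms
[g_c] with [f = sum_c f(y_c) g_c] for each of these forms ([exists_rank_op]).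
Then [f_i(v_j) = sum_c f_i(y_c) g_c(v_j)], so the trace of [theta t] is
recovered from [theta t] itself: feed [y_c] into input [i], apply [g_c] to
output [j], and sum over [c] ([theta_ttrace]).

For the second claim, [V] is finite-dimensional exactly when the identity of [V]
has the form [x |-> sum_c g_c(x) y_c]; in one direction use a basis and its
coordinate forms, in the other observe that the matrix [g_c(y_d)] is idempotent
and that [x |-> (g_c(x))_c] is an isomorphism onto its row space.  A unit
[I = theta (sum_c g_c (x) y_c)] applied to a vector, seen as an element of
[Hom_V^fr(0, 1)], gives [sum_c g_c(x) y_c = x].  Conversely, if this identity
holds then contracting [I * p] or [p * I] removes one entry of [p] and puts its
expansion, hence the same entry, at the beginning or at the end, which is what
the cycles in the unit axioms do.
*)

Set Implicit Arguments.
Unset Strict Implicit.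
Unset Printing Implicit Defensive.

Import GRing.Theory.
Local Open Scope ring_scope.

(** * Pure maps span the maps of finite rank *)

Section LinearMaps.
Variables (K : fieldType) (U W X : lmodType K).

Lemma linear_comp (G : W -> X) (F : U -> W) :
  linear G -> linear F -> linear (fun x => G (F x)).
Proof. by move=> lG lF a x y; rewrite lF lG. Qed.

Lemma linear_scaleE (F : U -> W) : linear F -> forall a x, F (a *: x) = a *: F x.
Proof. by move=> lF; apply: (linearZZ (mklin lF)). Qed.

Lemma linear_sumE (F : U -> W) : linear F -> forall I (s : seq I) (G : I -> U),
  F (\sum_(q <- s) G q) = \sum_(q <- s) F (G q).
Proof. by move=> lF I s G; apply: (linear_sum (mklin lF)). Qed.
End LinearMaps.

Section VectorSpace.
Variables (K : fieldType) (V : lmodType K) (k l : nat).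

Fact homfr_submod : submod_closed (fun f => f \in range (theta V k l)).
Proof.
split=> [|a _ _ /set_mem[x _ <-] /set_mem[y _ <-]]; apply: mem_range_theta.
  by exists 0; rewrite raddf0.
by exists (a *: x + y); rewrite linearP.
Qed.
HB.instance Definition _ :=
  SubChoice.copy (homfr V k l) (set_type (range (theta V k l))).
HB.instance Definition _ :=
  GRing.SubChoice_isSubLmodule.Build K _ _ (homfr V k l) homfr_submod.

Lemma val_homfrP (a : K) (p q : homfr V k l) :
  val (a *: p + q) = a *: val p + val q.
Proof. by []. Qed.

Definition pure (f : 'I_k -> dual V) (v : 'I_l -> V) : homfr V k l :=
  mk_homfr (ex_intro _ (tpair (ptens f) (ptens v)) erefl).

Lemma val_pure f v : val (pure f v) = theta V k l (tpair (ptens f) (ptens v)).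
Proof. by []. Qed.

Lemma pure_linear_r f w i : linear (fun x => pure f (upd w i x)).
Proof.
move=> a x y; apply: val_inj.
by rewrite val_homfrP !val_pure ptens_multilinear tpair_linearr linearP.
Qed.

Lemma pure_linear_l w i v : linear (fun g => pure (upd w i g) v).
Proof.
move=> a x y; apply: val_inj.
by rewrite val_homfrP !val_pure ptens_multilinear tpair_linearl linearP.
Qed.

(** Zero needs no separate case: it is [(-1) *: p + p] for any pure [p]. *)
Lemma homfr_ind (P : homfr V k l -> Prop) :
  (forall a p q, P p -> P q -> P (a *: p + q)) ->
  (forall f v, P (pure f v)) -> forall p, P p.
Proof.
move=> PD Pp.
have P0 : P 0.
  rewrite -(addNr (pure (fun=> 0) (fun=> 0))) -scaleN1r.
  by apply: PD.
have Pt t : forall p, val p = theta V k l t -> P p.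
  elim/tens_ind: t => [|a u v Pu Pv|f v] p Ep.
  - suff -> : p = 0 by [].
    by apply: val_inj; rewrite Ep raddf0.
  - pose h t := mk_homfr (ex_intro _ t (erefl (theta V k l t))).
    suff -> : p = a *: h u + h v by apply: PD; [apply: Pu | apply: Pv].
    by apply: val_inj; rewrite val_homfrP Ep linearP.
  - by suff -> : p = pure f v; last apply: val_inj.
by move=> p; have [t /esym] := homfr_preimage p; apply: Pt.
Qed.

(** The form in which pure maps are used: rewriting with linearity under nested
    operations is replaced by one proof that each side is linear. *)
Lemma homfr_ext (U : lmodType K) (F G : homfr V k l -> U) :
  linear F -> linear G -> (forall f v, F (pure f v) = G (pure f v)) -> F =1 G.
Proof.
move=> linF linG FG; elim/homfr_ind => // a p q Ep Eq.
by rewrite linF linG Ep Eq.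
Qed.
End VectorSpace.

(** * Actions and concatenation on pure maps *)

Section ActionsConcat.
Variables (K : fieldType) (V : lmodType K).

Lemma lact_linear k l (s : 'S_l) : linear (@homfr_lact K V k l s).
Proof.
move=> a p q; apply: val_inj; apply: linear_ext => x.
exact: (linearP (tact V s) a (val p x) (val q x)).
Qed.

Lemma ract_linear k l (s : 'S_k) :
  linear (fun p : homfr V k l => homfr_ract p s).
Proof. by move=> a p q; apply: val_inj; apply: linear_ext => x. Qed.

Lemma hcat_linear_l k l k' l' (p' : homfr V k' l') :
  linear (fun p : homfr V k l => homfr_hcat p p').
Proof.
move=> a p q; apply: val_inj; apply: tpow_ext => x.
rewrite val_homfrP lincE /= !tpow_liftE.
have E : forall y, sval (a *: p + q) y = a *: sval p y + sval q y by [].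
by rewrite E linearP lincE.
Qed.

Lemma hcat_linear_r k l k' l' (p : homfr V k l) :
  linear (@homfr_hcat K V k l k' l' p).
Proof.
move=> a p' q; apply: val_inj; apply: tpow_ext => x.
rewrite val_homfrP lincE /= !tpow_liftE.
have E : forall y, sval (a *: p' + q) y = a *: sval p' y + sval q y by [].
by rewrite E linearP.
Qed.

Lemma lact_pure k l (s : 'S_l) f v :
  homfr_lact s (pure f v : homfr V k l) = pure f (v \o s^-1%g).
Proof.
apply: val_inj; apply: tpow_ext => x.
rewrite -[LHS]/(tact V s (theta V k l _ (ptens x))) val_pure !thetaE.
by rewrite linearZZ tactE.
Qed.

Lemma ract_pure k l (s : 'S_k) f v :
  homfr_ract (pure f v : homfr V k l) s = pure (f \o s) v.
Proof.
apply: val_inj; apply: tpow_ext => x.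
rewrite -[LHS]/(theta V k l _ (tact V s (ptens x))) tactE val_pure !thetaE.
congr (_ *: _); rewrite [LHS](reindex_inj (@perm_inj _ s)).
by apply: eq_bigr => i _; rewrite /= permK.
Qed.

Lemma catfl T m n (w : 'I_m -> T) (w' : 'I_n -> T) i :
  catf w w' (lshift n i) = w i.
Proof. by rewrite /catf -[lshift _ _]/(unsplit (inl _)) unsplitK. Qed.

Lemma catfr T m n (w : 'I_m -> T) (w' : 'I_n -> T) i :
  catf w w' (rshift m i) = w' i.
Proof. by rewrite /catf -[rshift _ _]/(unsplit (inr _)) unsplitK. Qed.

Lemma hcat_pure k l k' l' f v f' v' :
  homfr_hcat (pure f v : homfr V k l) (pure f' v' : homfr V k' l') =
  pure (catf f f') (catf v v').
Proof.
apply: val_inj; apply: tcat_ext => w w'.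
rewrite [val (homfr_hcat _ _)]/= tmapE !val_pure !tcatE !thetaE tcatZ tcatE.
congr (_ *: _); rewrite big_split_ord /=.
by congr (_ * _); apply: eq_bigr => i _; rewrite ?catfl ?catfr.
Qed.

End ActionsConcat.

(** * Partial traces do not depend on the chosen tensor *)

Section FiniteRank.
Variables (K : fieldType) (V : lmodType K).

(** [theta] in degrees 1 and 1, as a plain endomorphism of [V], on the tensor
    whose terms are the pairs of [r]. *)
Definition rank_op (r : seq (V * dual V)) (x : V) : V :=
  \sum_(q <- r) (q.2 x : K) *: q.1.

Lemma rank_op_linear r : linear (rank_op r).
Proof.
move=> a x y; rewrite /rank_op scaler_sumr -big_split /=.
by apply: eq_bigr => q _; rewrite linearP scalerDl scalerA.
Qed.

Lemma formP (f : dual V) a x y : f (a *: x + y) = a * f x + f y :> K.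
Proof. exact: linearP. Qed.
Lemma formZ (f : dual V) a x : f (a *: x) = a * f x :> K.
Proof. exact: (linearZZ f). Qed.

Lemma form_rank_op (f : dual V) r x :
  f (rank_op r x) = \sum_(q <- r) (q.2 x : K) * f q.1 :> K.
Proof.
rewrite /rank_op raddf_sum; apply: eq_bigr => q _; exact: formZ.
Qed.

(** Each finite set of forms factors through a projection of finite rank.  The
    projection is enlarged one form at a time: what [f] fails to see through [P],
    namely [h = f - f o P], vanishes on the image of [P], and a vector [y] with
    [h y = 1] can be taken in the kernel of [P], where the forms already treated
    vanish. *)
Lemma exists_rank_op (s : seq (dual V)) : exists r : seq (V * dual V),
  forall f, f \in s -> forall x, f (rank_op r x) = f x.
Proof.
(* Idempotence is what makes h vanish on the image of P. *)
suff [r [_ rs]] : exists r, (forall x, rank_op r (rank_op r x) = rank_op r x) /\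
    forall f, f \in s -> forall x, f (rank_op r x) = f x by exists r.
elim: s => [|f s [r [rK rs]]]; first by exists [::]; split => // x;
  rewrite /rank_op !big_nil.
pose P := mklin (rank_op_linear r).
have PK x : P (P x) = P x by exact: rK.
pose h : dual V := f - (f \o P : {linear V -> K^o}).
have hE x : h x = f x - f (P x) :> K by [].
case: (pselect (forall x, h x = 0 :> K)) => [h0|].
  exists r; split => // g; rewrite inE => /orP[/eqP -> x|/rs //].
  by apply/esym/eqP; rewrite -subr_eq0; apply/eqP/(h0 x).
move=> /existsNP[z /eqP hz].
pose y := (h z)^-1 *: (z - P z).
have Py : P y = 0 by rewrite linearZZ linearB PK subrr scaler0.
have fy : f y = 1 :> K by rewrite formZ (linearB f) mulVf.
have hy : h y = 1 :> K by rewrite hE Py raddf0 subr0.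
have hP x : h (P x) = 0 :> K by rewrite hE PK subrr.
have gy g : g \in s -> g y = 0 :> K.
  by move=> gs; rewrite formZ (linearB g) (rs g gs) subrr mulr0.
have E x : rank_op ((y, h) :: r) x = (h x : K) *: y + P x.
  by rewrite /rank_op big_cons.
exists ((y, h) :: r); split => [x|g].
  have PE a u : P (a *: y + u) = P u by rewrite linearP Py scaler0 add0r.
  by rewrite !E PE PK formP hy hP mulr1 addr0.
rewrite inE => gs x; rewrite E formP; case/orP: gs => [/eqP ->|gs].
  by rewrite fy mulr1 hE subrK.
by rewrite gy // mulr0 add0r; apply: rs.
Qed.
End FiniteRank.

Section Trace.
Variables (K : fieldType) (V : lmodType K) (k l : nat).
Variables (i : 'I_k.+1) (j : 'I_l.+1).

Definition insert_at (y : V) (x : 'I_k -> V) (b : 'I_k.+1) : V :=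
  if unlift i b is Some a then x a else y.

Lemma insert_at_lift y x a : insert_at y x (lift i a) = x a.
Proof. by rewrite /insert_at liftK. Qed.

Lemma insert_at_self y x : insert_at y x i = y.
Proof. by rewrite /insert_at unlift_none. Qed.

Fact eval_slot_ml (g : dual V) :
  multilinear (fun v : 'I_l.+1 -> V => (g (v j) : K) *: ptens (v \o lift j)).
Proof.
move=> v b a x y; rewrite !upd_lift.
case: (unliftP j b) => [c ->|->]; rewrite /upd.
  rewrite (negPf (neq_lift _ _)) -/(upd _ _ _) ptens_multilinear.
  by rewrite scalerDr !scalerA mulrC.
by rewrite eqxx formP scalerDl scalerA.
Qed.
Definition eval_slot (g : dual V) : {linear tpow V l.+1 -> tpow V l} :=
  tpow_lift (eval_slot_ml g).

Lemma eval_slotE g v :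
  eval_slot g (ptens v) = (g (v j) : K) *: ptens (v \o lift j).
Proof. exact: tpow_liftE. Qed.

(** The partial trace seen from the map alone: the right-hand side mentions [t]
    only through [theta t].  For a pure [t] the sum over [q] produces
    [f_i (rank_op r v_j)], which is [f_i(v_j)] once [rank_op r] fixes [f_i].  The
    list [s] collects these [f_i], so that one [r] serves all terms of [t]. *)
Lemma theta_ttrace (t : tens (tpow (dual V) k.+1) (tpow V l.+1)) :
  exists s : seq (dual V), forall r : seq (V * dual V),
    (forall f, f \in s -> forall x, f (rank_op r x) = f x) ->
    forall x, theta V k l (ttrace V i j t) (ptens x) =
      \sum_(q <- r) eval_slot q.2 (theta V _ _ t (ptens (insert_at q.1 x))).
Proof.
elim/tens_ind: t => [|a u v [su Eu] [sv Ev]|f v].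
- exists [::] => r _ x; rewrite !raddf0 lin0E big1 // => q _.
  by rewrite raddf0.
- exists (su ++ sv) => r rs x.
  rewrite !linearP !lincE.
  rewrite (Eu r) => [|f fs]; last by apply: rs; rewrite mem_cat fs.
  rewrite (Ev r) => [|f fs]; last by apply: rs; rewrite mem_cat fs orbT.
  rewrite scaler_sumr -big_split; apply: eq_bigr => q _.
  by rewrite lincE linearP.
exists [:: f i] => r rs x; rewrite ttraceE linearZZ.
rewrite -[LHS]/(_ *: theta V k l _ (ptens x)) thetaE scalerA.
rewrite -(rs (f i)) ?inE // form_rank_op mulr_suml scaler_suml.
apply: eq_bigr => q _; rewrite thetaE linearZZ eval_slotE scalerA.
rewrite (bigD1_ord i) //= insert_at_self; congr (_ *: _).
under [in RHS]eq_bigr => a _ do rewrite insert_at_lift.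
by rewrite -mulrA mulrC.
Qed.

Lemma theta_ttrace0 (t : tens (tpow (dual V) k.+1) (tpow V l.+1)) :
  theta V _ _ t = 0 -> theta V k l (ttrace V i j t) = 0.
Proof.
move=> t0; have [s Es] := theta_ttrace t; have [r rs] := exists_rank_op s.
apply: tpow_ext => x; rewrite (Es r rs) t0 lin0E big1 // => q _.
by rewrite lin0E raddf0.
Qed.

(** Hence the chosen preimage in the definition of the partial trace may be
    replaced by any other. *)
Lemma ptraceE (p : homfr V k.+1 l.+1) t :
  val p = theta V _ _ t ->
  val (homfr_ptrace i j p) = theta V k l (ttrace V i j t).
Proof.
move=> Ep; have Et : theta V _ _ (theta_inv p) = val p.
  by rewrite /theta_inv; case: cid.
rewrite -[LHS]/(theta V k l (ttrace V i j (theta_inv p))).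
apply/eqP; rewrite -subr_eq0 -!linearB; apply/eqP/theta_ttrace0.
by rewrite linearB /= Et Ep subrr.
Qed.

Lemma ptrace_linear : linear (@homfr_ptrace K V k l i j).
Proof.
move=> a p q; have [t Et] := homfr_preimage p; have [u Eu] := homfr_preimage q.
apply: val_inj; rewrite val_homfrP.
rewrite (ptraceE (esym Et)) (ptraceE (esym Eu)) -!linearP; apply: ptraceE.
by rewrite val_homfrP linearP Et Eu.
Qed.

Lemma ptrace_pure (f : 'I_k.+1 -> dual V) (v : 'I_l.+1 -> V) :
  homfr_ptrace i j (pure f v) =
  (f i (v j) : K) *: pure (f \o lift i) (v \o lift j).
Proof.
apply: val_inj; rewrite (ptraceE (t := tpair (ptens f) (ptens v))) //.
by rewrite ttraceE linearZZ.
Qed.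
End Trace.

(** * Reindexing *)

Section Indices.

Lemma ord_add_ext T m n (F G : 'I_(m + n) -> T) :
  (forall i, F (lshift n i) = G (lshift n i)) ->
  (forall i, F (rshift m i) = G (rshift m i)) -> F = G.
Proof. by move=> Fl Fr; apply/funext => i; case: (split_ordP i) => j ->. Qed.

Lemma comp_permV T n (F G : 'I_n -> T) (s : 'S_n) : F \o s = G -> F = G \o s^-1%g.
Proof. by move=> <-; apply/funext => i; rewrite /= permKV. Qed.

Lemma tens_perm_lshift m n (a : 'S_m) (b : 'S_n) i :
  tens_perm a b (lshift n i) = lshift n (a i).
Proof.
by rewrite permE /tens_perm_fun -[lshift _ i]/(unsplit (inl _)) unsplitK.
Qed.

Lemma tens_perm_rshift m n (a : 'S_m) (b : 'S_n) i :
  tens_perm a b (rshift m i) = rshift m (b i).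
Proof.
by rewrite permE /tens_perm_fun -[rshift _ i]/(unsplit (inr _)) unsplitK.
Qed.

Lemma braid_lshift m n i :
  braid m n (lshift n i) = cast_ord (addnC n m) (rshift n i).
Proof. by rewrite permE /braid_fun -[lshift _ i]/(unsplit (inl _)) unsplitK. Qed.

Lemma braid_rshift m n i :
  braid m n (rshift m i) = cast_ord (addnC n m) (lshift m i).
Proof. by rewrite permE /braid_fun -[rshift _ i]/(unsplit (inr _)) unsplitK. Qed.

Lemma catf_tens_perm T m n (a : 'S_m) (b : 'S_n) (w : 'I_m -> T) w' :
  catf w w' \o tens_perm a b = catf (w \o a) (w' \o b).
Proof.
by apply: ord_add_ext => i; rewrite /= (tens_perm_lshift, tens_perm_rshift)
  !(catfl, catfr).
Qed.

Lemma catf_braid T m n (w : 'I_m -> T) (w' : 'I_n -> T) :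
  (catf w' w \o cast_ord (esym (addnC n m))) \o braid m n = catf w w'.
Proof.
by apply: ord_add_ext => i; rewrite /= (braid_lshift, braid_rshift) cast_ordK
  !(catfl, catfr).
Qed.

Lemma catfA T m n p (w : 'I_m -> T) (w' : 'I_n -> T) (w'' : 'I_p -> T) :
  catf w (catf w' w'') \o cast_ord (esym (addnA m n p)) = catf (catf w w') w''.
Proof.
apply: ord_add_ext => i.
- case: (split_ordP i) => a ->; rewrite !catfl /=.
    rewrite -[RHS](catfl w (catf w' w'')); congr (catf _ _ _).
    exact: val_inj.
  rewrite !catfr -[RHS](catfl w' w'') -[RHS](catfr w); congr (catf _ _ _).
  exact: val_inj.
rewrite !catfr -[RHS](catfr w' w'') -[RHS](catfr w) /=; congr (catf _ _ _).
by apply: val_inj; rewrite /= addnA.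
Qed.

(** Deleting position [i], then position [i'] of what remains, deletes the two
    original positions [i] and [lift i i'].  The inner index of the other order
    of deletion is [i.-1] or [i] according to the side of [i] on which
    [lift i i'] lies. *)
Lemma lift_swap_lt n (i : 'I_n.+2) (i' : 'I_n.+1) : (i' < i)%N ->
  [/\ inord i' = lift i i', lift (lift i i') (inord i.-1 : 'I_n.+1) = i &
      lift (lift i i') \o lift (inord i.-1 : 'I_n.+1) = lift i \o lift i'].
Proof.
move=> lti; have ltin := ltn_ord i; have ltin' := ltn_ord i'.
have vi : (inord i.-1 : 'I_n.+1) = i.-1 :> nat by rewrite inordK //; lia.
split; first by apply: val_inj; rewrite /= inordK /bump; lia.
  by apply: val_inj; rewrite /= vi /bump; lia.
by apply/funext => a; apply: val_inj; rewrite /= vi /bump; lia.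
Qed.

Lemma lift_swap_ge n (i : 'I_n.+2) (i' : 'I_n.+1) : (i <= i')%N ->
  [/\ inord i'.+1 = lift i i', lift (lift i i') (inord i : 'I_n.+1) = i &
      lift (lift i i') \o lift (inord i : 'I_n.+1) = lift i \o lift i'].
Proof.
move=> lti; have ltin := ltn_ord i; have ltin' := ltn_ord i'.
have vi : (inord i : 'I_n.+1) = i :> nat by rewrite inordK //; lia.
split; first by apply: val_inj; rewrite /= inordK /bump; lia.
  by apply: val_inj; rewrite /= vi /bump; lia.
by apply/funext => a; apply: val_inj; rewrite /= vi /bump; lia.
Qed.

Lemma lift_del_letter n (s : 'S_n.+1) i :
  lift (s i) \o del_letter s (s i) = s \o lift i.
Proof.
by apply/funext => a; rewrite /= permE del_letter_funE permK.
Qed.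

Lemma liftV_del_letter n (s : 'S_n.+1) j :
  lift (s^-1%g j) \o (del_letter s j)^-1%g = s^-1%g \o lift j.
Proof.
apply/esym/comp_permV/funext => a.
by rewrite /= [del_letter _ _ _]permE del_letter_funE permK.
Qed.

(** The type of [lshift n i] is read as [(m + n).+1], which is convertible to
    [m.+1 + n]; on the right-hand block [m + n.+1] is only propositionally a
    successor, whence the cast in the companion lemma. *)
Lemma catf_lift_lshift T m n (w : 'I_m.+1 -> T) (w' : 'I_n -> T)
    (i : 'I_m.+1) :
  catf w w' \o lift (lshift n i : 'I_(m + n).+1) = catf (w \o lift i) w'.
Proof.
apply: ord_add_ext => a /=.
  rewrite catfl -[RHS](catfl w w'); congr (catf _ _ _); exact: val_inj.
rewrite catfr -[RHS](catfr w w'); congr (catf _ _ _); apply: val_inj.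
by have := ltn_ord i; rewrite /= /bump; lia.
Qed.

Lemma catf_lift_rshift T m n (w : 'I_m -> T) (w' : 'I_n.+1 -> T)
    (i : 'I_n.+1) :
  (catf w w' \o cast_ord (esym (addnS m n))) \o
     lift (cast_ord (addnS m n) (rshift m i)) = catf w (w' \o lift i).
Proof.
apply: ord_add_ext => a /=.
  rewrite catfl -[RHS](catfl w w'); congr (catf _ _ _); apply: val_inj.
  by have := ltn_ord a; rewrite /= /bump; lia.
rewrite catfr -[RHS](catfr w w'); congr (catf _ _ _); apply: val_inj.
by rewrite /= /bump; lia.
Qed.
End Indices.

(** * The TRAP axioms *)

Section TrapStructure.
Variables (K : fieldType) (V : lmodType K).
Notation P := (homfr V).

(** A copy of [recast] whose type mentions [homfr] directly, so that its vector
    space structure is found. *)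
Definition homfr_recast k k' l l' (ek : k = k') (el : l = l') (p : P k l) :
  P k' l' := @recast (homfr_trap V) _ _ _ _ ek el p.

Lemma recast_linear k k' l l' (ek : k = k') (el : l = l') :
  linear (homfr_recast ek el).
Proof. by case: _ / ek; case: _ / el. Qed.

Lemma recast_pure k k' l l' (ek : k = k') (el : l = l') f v :
  homfr_recast ek el (pure f v) =
  pure (f \o cast_ord (esym ek)) (v \o cast_ord (esym el)).
Proof.
case: _ / ek; case: _ / el; rewrite /homfr_recast /=.
by congr pure; apply/funext => i; rewrite /= cast_ord_id.
Qed.

Lemma homfr_lact1 k l (p : P k l) : homfr_lact 1%g p = p.
Proof.
elim/homfr_ind: p => [a p q Ep Eq|f v]; first by rewrite lact_linear Ep Eq.
by rewrite lact_pure; congr pure; apply/funext => i; rewrite /= invg1 perm1.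
Qed.

Lemma homfr_ract1 k l (p : P k l) : homfr_ract p 1%g = p.
Proof.
elim/homfr_ind: p => [a p q Ep Eq|f v]; first by rewrite ract_linear Ep Eq.
by rewrite ract_pure; congr pure; apply/funext => i; rewrite /= perm1.
Qed.

Lemma homfr_lactM k l (s t : 'S_l) (p : P k l) :
  homfr_lact (t * s)%g p = homfr_lact s (homfr_lact t p).
Proof.
elim/homfr_ind: p => [a p q Ep Eq|f v]; first by rewrite !lact_linear Ep Eq.
rewrite !lact_pure; congr pure; apply/funext => i.
by rewrite /= invMg permM.
Qed.

Lemma homfr_ractM k l (s t : 'S_k) (p : P k l) :
  homfr_ract p (t * s)%g = homfr_ract (homfr_ract p s) t.
Proof.
elim/homfr_ind: p => [a p q Ep Eq|f v]; first by rewrite !ract_linear Ep Eq.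
by rewrite !ract_pure; congr pure; apply/funext => i; rewrite /= permM.
Qed.

Lemma homfr_lractA k l (s : 'S_l) (t : 'S_k) (p : P k l) :
  homfr_ract (homfr_lact s p) t = homfr_lact s (homfr_ract p t).
Proof. by apply: val_inj; apply: linear_ext. Qed.

Lemma homfr_hcatA k l k' l' k'' l'' (p : P k l) (p' : P k' l') (p'' : P k'' l'') :
  homfr_recast (addnA k k' k'') (addnA l l' l'')
    (homfr_hcat p (homfr_hcat p' p'')) =
  homfr_hcat (homfr_hcat p p') p''.
Proof.
have reL := recast_linear (addnA k k' k'') (addnA l l' l'').
move: p; apply: homfr_ext => [||f v].
- exact: linear_comp reL (hcat_linear_l _).
- exact: linear_comp (hcat_linear_l p'') (hcat_linear_l p').
move: p'; apply: homfr_ext => [||f' v'].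
- exact: linear_comp reL (linear_comp (hcat_linear_r _) (hcat_linear_l p'')).
- exact: linear_comp (hcat_linear_l p'') (hcat_linear_r _).
move: p''; apply: homfr_ext => [||f'' v''].
- exact: linear_comp reL (linear_comp (hcat_linear_r _) (hcat_linear_r _)).
- exact: hcat_linear_r.
by rewrite !hcat_pure recast_pure !catfA.
Qed.

Lemma homfr_hcat_unit : exists I0 : P 0 0, forall k l (p : P k l),
  homfr_hcat I0 p = p /\ homfr_recast (addn0 k) (addn0 l) (homfr_hcat p I0) = p.
Proof.
(* The lists are empty, so this is the identity of the base field. *)
exists (pure (fun=> 0) (fun=> 0)) => k l p; split; move: p.
  apply: homfr_ext => [||f v] //; first exact: hcat_linear_r.
  rewrite hcat_pure; congr pure; apply/funext => i.
    by rewrite -[RHS](catfr (fun _ : 'I_0 => 0) f); congr catf; apply: val_inj.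
  by rewrite -[RHS](catfr (fun _ : 'I_0 => 0) v); congr catf; apply: val_inj.
apply: homfr_ext => [||f v] //.
  exact: linear_comp (recast_linear _ _) (hcat_linear_l _).
rewrite hcat_pure recast_pure; congr pure; apply/funext => i /=.
  by rewrite -[RHS](catfl f (fun _ : 'I_0 => 0)); congr catf; apply: val_inj.
by rewrite -[RHS](catfl v (fun _ : 'I_0 => 0)); congr catf; apply: val_inj.
Qed.

Lemma homfr_hcat_act k l k' l' (s : 'S_l) (t : 'S_k) (s' : 'S_l') (t' : 'S_k')
    (p : P k l) (p' : P k' l') :
  homfr_hcat (homfr_ract (homfr_lact s p) t) (homfr_ract (homfr_lact s' p') t')
  = homfr_ract (homfr_lact (tens_perm s s') (homfr_hcat p p')) (tens_perm t t').
Proof.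
have actL m n (u : 'S_n) (w : 'S_m) :=
  linear_comp (ract_linear w) (@lact_linear K V m n u).
move: p; apply: homfr_ext => [||f v].
- exact: linear_comp (hcat_linear_l _) (actL _ _ _ _).
- exact: linear_comp (actL _ _ _ _) (hcat_linear_l _).
move: p'; apply: homfr_ext => [||f' v'].
- exact: linear_comp (hcat_linear_r _) (actL _ _ _ _).
- exact: linear_comp (actL _ _ _ _) (hcat_linear_r _).
rewrite !(lact_pure, ract_pure, hcat_pure) catf_tens_perm; congr pure.
apply: comp_permV; rewrite catf_tens_perm.
by congr catf; apply/funext => i; rewrite /= permK.
Qed.

Lemma homfr_hcatC k l k' l' (p : P k l) (p' : P k' l') :
  homfr_lact (braid l l') (homfr_hcat p p') =
  homfr_ract (homfr_recast (addnC k' k) (addnC l' l) (homfr_hcat p' p))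
    (braid k k').
Proof.
have rightL := linear_comp (ract_linear (braid k k'))
  (recast_linear (addnC k' k) (addnC l' l)).
move: p; apply: homfr_ext => [||f v].
- exact: linear_comp (lact_linear _) (hcat_linear_l _).
- exact: linear_comp rightL (hcat_linear_r _).
move: p'; apply: homfr_ext => [||f' v'].
- exact: linear_comp (lact_linear _) (hcat_linear_r _).
- exact: linear_comp rightL (hcat_linear_l _).
rewrite !hcat_pure recast_pure lact_pure ract_pure catf_braid; congr pure.
by apply/esym/comp_permV; rewrite catf_braid.
Qed.

(** Both sides contract the same two pairs of entries of a pure map; the
    hypotheses say that [(i1, lift i i')] names the same pair of positions as
    [(i', i)] in the opposite order. *)
Lemma ptrace_swap k l (p : P k.+2 l.+2) (i : 'I_k.+2) (j : 'I_l.+2)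
    (i' i1 : 'I_k.+1) (j' j1 : 'I_l.+1) :
  lift (lift i i') i1 = i -> lift (lift j j') j1 = j ->
  lift (lift i i') \o lift i1 = lift i \o lift i' ->
  lift (lift j j') \o lift j1 = lift j \o lift j' ->
  homfr_ptrace i' j' (homfr_ptrace i j p) =
  homfr_ptrace i1 j1 (homfr_ptrace (lift i i') (lift j j') p).
Proof.
move=> Ei Ej Ci Cj; move: p; apply: homfr_ext => [||f v].
- exact: linear_comp (ptrace_linear _ _) (ptrace_linear _ _).
- exact: linear_comp (ptrace_linear _ _) (ptrace_linear _ _).
rewrite !ptrace_pure !(linear_scaleE (ptrace_linear _ _)) !ptrace_pure.
rewrite !scalerA; congr (_ *: pure _ _); first by rewrite /= Ei Ej mulrC.
  exact: (congr1 (comp f) (esym Ci)).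
exact: (congr1 (comp v) (esym Cj)).
Qed.

Lemma homfr_ptraceC k l (p : P k.+2 l.+2) (i : 'I_k.+2) (j : 'I_l.+2)
    (i' : 'I_k.+1) (j' : 'I_l.+1) :
  [/\ i' < i -> j' < j ->
        homfr_ptrace i' j' (homfr_ptrace i j p) =
        homfr_ptrace (inord i.-1) (inord j.-1)
          (homfr_ptrace (inord i') (inord j') p),
      i <= i' -> j' < j ->
        homfr_ptrace i' j' (homfr_ptrace i j p) =
        homfr_ptrace (inord i) (inord j.-1)
          (homfr_ptrace (inord i'.+1) (inord j') p),
      i' < i -> j <= j' ->
        homfr_ptrace i' j' (homfr_ptrace i j p) =
        homfr_ptrace (inord i.-1) (inord j)
          (homfr_ptrace (inord i') (inord j'.+1) p) &
      i <= i' -> j <= j' ->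
        homfr_ptrace i' j' (homfr_ptrace i j p) =
        homfr_ptrace (inord i) (inord j)
          (homfr_ptrace (inord i'.+1) (inord j'.+1) p)]%N.
Proof.
split=> [/lift_swap_lt|/lift_swap_ge|/lift_swap_lt|/lift_swap_ge] [-> Ei Ci];
  [move/lift_swap_lt|move/lift_swap_lt|move/lift_swap_ge|move/lift_swap_ge];
  by case=> -> Ej Cj; apply: ptrace_swap.
Qed.

Lemma homfr_ptrace_act k l (p : P k.+1 l.+1) (s : 'S_l.+1) (t : 'S_k.+1) i j :
  homfr_ptrace i j (homfr_ract (homfr_lact s p) t) =
  homfr_ract (homfr_lact (del_letter s j) (homfr_ptrace (t i) (s^-1%g j) p))
    (del_letter t (t i)).
Proof.
move: p; apply: homfr_ext => [||f v].
- exact: linear_comp (ptrace_linear i j)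
    (linear_comp (ract_linear t) (lact_linear s)).
- exact: linear_comp (linear_comp (ract_linear _) (lact_linear _))
    (ptrace_linear _ _).
rewrite lact_pure ract_pure !ptrace_pure (linear_scaleE (lact_linear _)).
rewrite (linear_scaleE (ract_linear _)) lact_pure ract_pure.
congr (_ *: pure _ _).
  exact: (congr1 (comp f) (esym (lift_del_letter t i))).
exact: (congr1 (comp v) (esym (liftV_del_letter s j))).
Qed.

Lemma homfr_ptrace_hcatl k l k' l' (p : P k.+1 l.+1) (p' : P k' l')
    (i : 'I_k.+1) (j : 'I_l.+1) :
  homfr_ptrace (lshift k' i : 'I_(k + k').+1) (lshift l' j : 'I_(l + l').+1)
    (homfr_hcat p p' : P (k + k').+1 (l + l').+1) =
  homfr_hcat (homfr_ptrace i j p) p'.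
Proof.
have trL := @ptrace_linear _ V (k + k') (l + l') (lshift k' i) (lshift l' j).
move: p; apply: homfr_ext => [||f v].
- exact: linear_comp trL (@hcat_linear_l K V k.+1 l.+1 k' l' p').
- exact: linear_comp (@hcat_linear_l K V k l k' l' p') (ptrace_linear i j).
move: p'; apply: homfr_ext => [||f' v'].
- exact: linear_comp trL (@hcat_linear_r _ V k.+1 l.+1 k' l' _).
- exact: hcat_linear_r.
rewrite hcat_pure ptrace_pure (linear_scaleE (hcat_linear_l _)) hcat_pure.
etransitivity; first exact: (@ptrace_pure _ V (k + k') (l + l')).
by rewrite !catf_lift_lshift !catfl.
Qed.

Lemma homfr_ptrace_hcatr k l k' l' (p : P k l) (p' : P k'.+1 l'.+1)
    (i : 'I_k'.+1) (j : 'I_l'.+1) :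
  homfr_ptrace (cast_ord (addnS k k') (rshift k i))
    (cast_ord (addnS l l') (rshift l j))
    (homfr_recast (addnS k k') (addnS l l') (homfr_hcat p p')) =
  homfr_hcat p (homfr_ptrace i j p').
Proof.
have trL := linear_comp
  (@ptrace_linear _ V _ _ (cast_ord (addnS k k') (rshift k i))
     (cast_ord (addnS l l') (rshift l j)))
  (recast_linear (addnS k k') (addnS l l')).
move: p; apply: homfr_ext => [||f v].
- exact: linear_comp trL (hcat_linear_l _).
- exact: hcat_linear_l.
move: p'; apply: homfr_ext => [||f' v'].
- exact: linear_comp trL (hcat_linear_r _).
- exact: linear_comp (hcat_linear_r _) (ptrace_linear _ _).
rewrite hcat_pure recast_pure !ptrace_pure !catf_lift_rshift.
by rewrite (linear_scaleE (hcat_linear_r _)) hcat_pure /= !cast_ordK !catfr.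
Qed.

Lemma homfr_is_trap : is_trap (homfr_trap V).
Proof.
split.
- exact: homfr_lact1.
- exact: homfr_lactM.
- exact: homfr_ract1.
- exact: homfr_ractM.
- exact: homfr_lractA.
- exact: homfr_hcatA.
- exact: homfr_hcat_unit.
- exact: homfr_hcat_act.
- exact: homfr_hcatC.
- exact: homfr_ptraceC.
- exact: homfr_ptrace_act.
- exact: homfr_ptrace_hcatl.
- exact: homfr_ptrace_hcatr.
Qed.
End TrapStructure.

(** * Finite dimension as a finite-rank identity *)

Section FiniteDimension.
Variables (K : fieldType) (V : lmodType K).

Lemma finite_dimensional_rank_op :
  finite_dimensional V -> exists r : seq (V * dual V), rank_op r =1 id.
Proof.
move=> [n [[v2r lin_v2r [r2v v2rK r2vK]]]].
pose phi := mklin lin_v2r.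
have coordL c : linear (fun x => phi x 0 c : K^o).
  by move=> a x y; rewrite linearP !mxE.
pose basis_pair c := (r2v (delta_mx 0 c), mklin (coordL c) : dual V).
exists [seq basis_pair c | c <- index_enum 'I_n] => x.
apply: (can_inj v2rK); rewrite -[LHS]/(phi _) /rank_op big_map.
rewrite (linear_sum phi) [RHS]row_sum_delta; apply: eq_bigr => c _.
rewrite (linearZZ phi); congr (_ *: _); exact: r2vK.
Qed.

(** With [r] the list of pairs [(y_c, g_c)], the matrix [M] with entries
    [g_c(y_d)] is idempotent, being [coords o comb] for [comb o coords = id].  So
    [coords] identifies [V] with the row space of [M], which has a basis even
    when the [y_c] are dependent. *)
Lemma rank_op_finite_dimensional (r : seq (V * dual V)) :
  rank_op r =1 id -> finite_dimensional V.
Proof.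
move=> rid; pose n := size r.
pose y (c : 'I_n) := (tnth (in_tuple r) c).1.
pose g (c : 'I_n) := (tnth (in_tuple r) c).2.
have sumE (x : V) : \sum_c (g c x : K) *: y c = x.
  by rewrite -[RHS]rid /rank_op (big_tnth _ _ r).
pose coords (x : V) : 'rV[K]_n := \row_c g c x.
pose comb (u : 'rV[K]_n) : V := \sum_c u 0 c *: y c.
have coordsK x : comb (coords x) = x.
  by rewrite -[RHS]sumE; apply: eq_bigr => c _; rewrite mxE.
have coordsL : linear coords.
  by move=> a x z; apply/rowP => c; rewrite !mxE; apply: formP.
pose M : 'M[K]_n := \matrix_d coords (y d).
have combM u : coords (comb u) = u *m M.
  apply/rowP => c; rewrite !mxE (linear_sum (g c)); apply: eq_bigr => d _.
  by rewrite !mxE; exact: (linearZZ (g c)).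
pose B := row_base M.
have coords_sub x : (coords x <= B)%MS.
  by rewrite eq_row_base -(coordsK x) combM submxMl.
have coords_fix (u : 'rV_(\rank M)) : coords (comb (u *m B)) = u *m B.
  have /submxP[w Ew] : (u *m B <= M)%MS by rewrite -(eq_row_base M) submxMl.
  by rewrite Ew -combM coordsK.
exists (\rank M); constructor.
exists (fun x => coords x *m pinvmx B).
  by move=> a x z; rewrite coordsL mulmxDl -scalemxAl.
exists (fun u => comb (u *m B)) => [x|u].
  by rewrite mulmxKpV ?coordsK.
by rewrite coords_fix mulmxKp ?row_base_free.
Qed.
End FiniteDimension.

(** * A unit forces finite dimension *)

Section UnitaryImplies.
Variables (K : fieldType) (V : lmodType K).
Notation P := (homfr V).

Definition vec (x : V) : P 0 1 := pure (fun=> 0) (fun=> x).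

Lemma vec_linear : linear vec.
Proof.
have E x : vec x = pure (fun=> 0) (upd (fun=> 0) ord0 x).
  by congr pure; apply/funext => i; rewrite /upd (ord1 i).
by move=> a x y; rewrite !E; apply: pure_linear_r.
Qed.

Lemma vec_inj : injective vec.
Proof.
move=> x y /(congr1 val).
move/(congr1 (fun h : {linear _ -> _} => h (ptens (fun=> 0)))).
rewrite !val_pure !thetaE !big_ord0 !scale1r.
have ev0_ml : multilinear (fun w : 'I_1 -> V => w ord0).
  by move=> w i a u v; rewrite (ord1 i) /upd.
by move/(congr1 (tpow_lift ev0_ml)); rewrite !tpow_liftE.
Qed.

(** Contracting the form of [I] with the vector [x] evaluates [I] at [x]. *)
Lemma ptrace_hcat_vec (I : P 1 1) : exists r : seq (V * dual V), forall x,
  homfr_ptrace ord0 ord_max (homfr_hcat I (vec x) : P 1 2) = vec (rank_op r x).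
Proof.
elim/homfr_ind: I => [a p q [rp Ep] [rq Eq]|f y].
  exists ([seq (a *: u.1, u.2) | u <- rp] ++ rq) => x.
  have -> : rank_op ([seq (a *: u.1, u.2) | u <- rp] ++ rq) x =
            a *: rank_op rp x + rank_op rq x.
    rewrite /rank_op big_cat big_map scaler_sumr; congr (_ + _).
    by apply: eq_bigr => u _; rewrite !scalerA mulrC.
  rewrite vec_linear -Ep -Eq; move: p q a {Ep Eq}.
  suff L : linear (fun p : P 1 1 =>
    homfr_ptrace ord0 ord_max (homfr_hcat p (vec x) : P 1 2)).
    by move=> p q a; apply: L.
  exact: linear_comp (@ptrace_linear _ V 0 1 ord0 ord_max)
    (@hcat_linear_l _ V 1 1 0 1 (vec x)).
exists [:: (y ord0, f ord0)] => x; rewrite hcat_pure.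
rewrite /rank_op big_seq1 (linear_scaleE vec_linear).
etransitivity; first exact: (@ptrace_pure _ V 0 1).
congr ((_ : K) *: pure _ _).
- by congr (_ _ _); [rewrite -[RHS](catfl f (fun _ : 'I_0 => 0)) |
    rewrite -[RHS](catfr y (fun _ : 'I_1 => x) ord0)]; congr catf; apply: val_inj.
- by apply/funext => -[].
apply/funext => i; rewrite -[RHS](catfl y (fun _ : 'I_1 => x)) /=; congr catf.
by apply: val_inj; rewrite /= (ord1 i).
Qed.

(** The unit is tested on [Hom_V^fr(0, 1)], a copy of [V]: its elements involve
    no forms, so the unit axiom there says [I x = x] for every vector [x]. *)
Lemma unitary_finite_dimensional :
  unitary (homfr_trap V) -> finite_dimensional V.
Proof.
move=> [I Iunit]; have [r Er] := ptrace_hcat_vec I.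
apply: (rank_op_finite_dimensional (r := r)) => x; apply: vec_inj.
rewrite -Er; have [+ _ _ _] := Iunit 0%N 1%N (vec x) => /(_ ord_max isT) /= ->.
exact: lact_pure.
Qed.
End UnitaryImplies.

(** * The unit of a finite-dimensional space *)

Section UnitaryIf.
Variables (K : fieldType) (V : lmodType K).
Notation P := (homfr V).

Lemma val_cyc n a b (i : 'I_n) : cyc n a b i =
  (if [&& a <= i, i <= b & b < n] then (if i == b :> nat then a else i.+1)
   else i)%N :> nat.
Proof.
rewrite permE /cyc_fun; case: ifP => // /and3P[ai ib bn].
rewrite val_insubd ifT //; case: eqP => [_|/eqP nib].
  exact: leq_ltn_trans ai (ltn_ord i).
by apply: leq_ltn_trans bn; rewrite ltn_neqAle nib.
Qed.

Lemma upd_same (U : lmodType K) n (w : 'I_n -> U) a : upd w a (w a) = w.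
Proof. by apply/funext => i; rewrite /upd; case: eqP => [->|]. Qed.

Definition consf T n (x : T) (w : 'I_n -> T) : 'I_n.+1 -> T :=
  catf (fun _ : 'I_1 => x) w.

Definition rconsf T n (w : 'I_n -> T) (x : T) : 'I_n.+1 -> T :=
  catf w (fun _ : 'I_1 => x) \o cast_ord (esym (addn1 n)).

Lemma consf_ord0 T n (w : 'I_n -> T) x : consf x w ord0 = x.
Proof.
rewrite -[RHS](catfl (fun _ : 'I_1 => x) w ord0) /consf; congr catf.
exact: val_inj.
Qed.

Lemma consf_lift0 T n (w : 'I_n -> T) x a : consf x w (lift ord0 a) = w a.
Proof.
rewrite -[RHS](catfr (fun _ : 'I_1 => x)) /consf; congr catf; exact: val_inj.
Qed.

Lemma rconsf_max T n (w : 'I_n -> T) x : rconsf w x ord_max = x.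
Proof.
rewrite -[RHS](catfr w (fun _ : 'I_1 => x) ord0) /rconsf /=; congr catf.
by apply: val_inj; rewrite /= addn0.
Qed.

Lemma rconsf_lift_max T n (w : 'I_n -> T) x a :
  rconsf w x (lift ord_max a) = w a.
Proof.
rewrite -[RHS](catfl w (fun _ : 'I_1 => x)) /rconsf /=; congr catf.
by apply: val_inj; apply: lift_max.
Qed.

(** The source of the cycles in the unit axioms: when entry [a] is deleted, the
    new entry [x] stands in front of the list instead of at the vacant place. *)
Lemma consf_skip (U : lmodType K) n (w : 'I_n -> U) x (a : 'I_n) :
  consf x w \o lift (lift ord0 a) = upd w a x \o (cyc n 0 a)^-1%g.
Proof.
apply: comp_permV; apply/funext => /= i; rewrite /upd.
case: eqP => [->|/eqP nia].
  rewrite -[RHS](consf_ord0 w x); congr consf; apply: val_inj.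
  by rewrite /= val_cyc leqnn ltn_ord eqxx.
rewrite -[RHS](consf_lift0 w x); congr consf; apply: val_inj.
have {}nia : (i : nat) <> a by move=> ia; case/eqP: nia; apply: val_inj.
rewrite /= val_cyc ltn_ord (introF eqP nia) andbT /=.
by case: (leqP i a) => ? /=; rewrite /bump; lia.
Qed.

Lemma rconsf_skip (U : lmodType K) n (w : 'I_n -> U) x (a : 'I_n) :
  rconsf w x \o lift (lift ord_max a) = upd w a x \o cyc n a n.-1.
Proof.
apply/funext => /= i; rewrite /upd /=.
have lin := ltn_ord i; have lan := ltn_ord a.
have va : bump n a = a by rewrite /bump; lia.
have le_in : (i <= n.-1)%N by lia.
have lt_nn : (n.-1 < n)%N by lia.
have := val_cyc a n.-1 i; rewrite le_in lt_nn !andbT => vc.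
have -> : (cyc n a n.-1 i == a) = (i == n.-1 :> nat).
  rewrite -val_eqE /= vc; case: (leqP a i) => ai; last by lia.
  by case: (i =P n.-1 :> nat) => ? /=; lia.
case: eqP vc => [ii|ni] vc.
  rewrite -[RHS](rconsf_max w x); congr rconsf; apply: val_inj.
  by rewrite /= va /bump; lia.
rewrite -[RHS](rconsf_lift_max w x); congr rconsf; apply: val_inj.
by rewrite /= va vc; case: (leqP a i) => ? /=; rewrite /bump; lia.
Qed.

Variable r : seq (V * dual V).
Hypothesis r_id : rank_op r =1 id.

(** Expansion of one vector, and dually of one form, along the identity
    [rank_op r = id]. *)
Lemma sum_pure_r k l (f : 'I_k -> dual V) (w : 'I_l -> V) a :
  \sum_(q <- r) (q.2 (w a) : K) *: pure f (upd w a q.1) = pure f w.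
Proof.
rewrite -[RHS](congr1 (pure f) (upd_same w a)) -[in RHS](r_id (w a)).
pose F := mklin (pure_linear_r f w a).
rewrite -[RHS]/(F (rank_op r (w a))) linear_sum; apply: eq_bigr => q _.
by rewrite (linearZZ F).
Qed.

Lemma sum_pure_l k l (w : 'I_k -> dual V) a (v : 'I_l -> V) :
  \sum_(q <- r) (w a q.1 : K) *: pure (upd w a q.2) v = pure w v.
Proof.
have Ew : w a = \sum_(q <- r) (w a q.1 : K) *: q.2 :> dual V.
  apply: linear_ext => x; rewrite -[in LHS](r_id x) form_rank_op.
  elim: r => [|q s IH]; first by rewrite !big_nil.
  by rewrite !big_cons lincE -IH mulrC.
rewrite -[RHS](congr1 (fun g => pure g v) (upd_same w a)) [in RHS]Ew.
pose F := mklin (pure_linear_l w a v).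
rewrite -[RHS]/(F _) linear_sum; apply: eq_bigr => q _.
by rewrite (linearZZ F).
Qed.

Definition identity_map : P 1 1 := \sum_(q <- r) pure (fun=> q.2) (fun=> q.1).

Lemma ptrace_unit_hcat k l (f : 'I_k -> dual V) (v : 'I_l -> V) i j :
  homfr_ptrace i j (homfr_hcat identity_map (pure f v) : P k.+1 l.+1) =
  \sum_(q <- r) (consf q.2 f i (consf q.1 v j) : K) *:
    pure (consf q.2 f \o lift i) (consf q.1 v \o lift j).
Proof.
have L := linear_comp (@ptrace_linear _ V k l i j)
  (@hcat_linear_l _ V 1 1 k l (pure f v)).
rewrite [LHS](linear_sumE L); apply: eq_bigr => q _.
by rewrite hcat_pure; apply: (@ptrace_pure _ V k l).
Qed.

Lemma ptrace_hcat_unit k l (f : 'I_k -> dual V) (v : 'I_l -> V) i j :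
  homfr_ptrace i j
    (homfr_recast (addn1 k) (addn1 l) (homfr_hcat (pure f v) identity_map)) =
  \sum_(q <- r) (rconsf f q.2 i (rconsf v q.1 j) : K) *:
    pure (rconsf f q.2 \o lift i) (rconsf v q.1 \o lift j).
Proof.
have L := linear_comp (linear_comp (@ptrace_linear _ V k l i j)
  (recast_linear (addn1 k) (addn1 l))) (hcat_linear_r (pure f v)).
rewrite [LHS](linear_sumE L); apply: eq_bigr => q _.
by rewrite hcat_pure recast_pure ptrace_pure.
Qed.

Lemma comp_consf_lift0 T n (w : 'I_n -> T) x : consf x w \o lift ord0 = w.
Proof. by apply/funext => a; apply: consf_lift0. Qed.

Lemma comp_rconsf_lift_max T n (w : 'I_n -> T) x : rconsf w x \o lift ord_max = w.
Proof. by apply/funext => a; apply: rconsf_lift_max. Qed.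

Lemma unit_hcat_lact k l (p : P k l) (a : 'I_l) :
  homfr_ptrace ord0 (lift ord0 a) (homfr_hcat identity_map p : P k.+1 l.+1) =
  homfr_lact (cyc l 0 a) p.
Proof.
move: p; apply: homfr_ext => [||f v].
- exact: linear_comp (@ptrace_linear _ V k l _ _) (@hcat_linear_r _ V 1 1 k l _).
- exact: lact_linear.
rewrite ptrace_unit_hcat -(sum_pure_r f v a) (linear_sumE (lact_linear _)).
apply: eq_bigr => q _; rewrite (linear_scaleE (lact_linear _)) lact_pure.
by rewrite comp_consf_lift0 consf_skip consf_ord0 consf_lift0.
Qed.

Lemma unit_hcat_ract k l (p : P k l) (a : 'I_k) :
  homfr_ptrace (lift ord0 a) ord0 (homfr_hcat identity_map p : P k.+1 l.+1) =
  homfr_ract p (cyc k 0 a)^-1%g.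
Proof.
move: p; apply: homfr_ext => [||f v].
- exact: linear_comp (@ptrace_linear _ V k l _ _) (@hcat_linear_r _ V 1 1 k l _).
- exact: ract_linear.
rewrite ptrace_unit_hcat -(sum_pure_l f a v) (linear_sumE (ract_linear _)).
apply: eq_bigr => q _; rewrite (linear_scaleE (ract_linear _)) ract_pure.
by rewrite comp_consf_lift0 consf_skip consf_ord0 consf_lift0.
Qed.

Lemma hcat_unit_lact k l (p : P k l) (a : 'I_l) :
  homfr_ptrace ord_max (lift ord_max a)
    (homfr_recast (addn1 k) (addn1 l) (homfr_hcat p identity_map)) =
  homfr_lact (cyc l a l.-1)^-1%g p.
Proof.
move: p; apply: homfr_ext => [||f v].
- exact: linear_comp (linear_comp (@ptrace_linear _ V k l _ _)
    (recast_linear (addn1 k) (addn1 l))) (hcat_linear_l _).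
- exact: lact_linear.
rewrite ptrace_hcat_unit -(sum_pure_r f v a) (linear_sumE (lact_linear _)).
apply: eq_bigr => q _; rewrite (linear_scaleE (lact_linear _)) lact_pure.
by rewrite invgK comp_rconsf_lift_max rconsf_skip rconsf_max rconsf_lift_max.
Qed.

Lemma hcat_unit_ract k l (p : P k l) (a : 'I_k) :
  homfr_ptrace (lift ord_max a) ord_max
    (homfr_recast (addn1 k) (addn1 l) (homfr_hcat p identity_map)) =
  homfr_ract p (cyc k a k.-1).
Proof.
move: p; apply: homfr_ext => [||f v].
- exact: linear_comp (linear_comp (@ptrace_linear _ V k l _ _)
    (recast_linear (addn1 k) (addn1 l))) (hcat_linear_l _).
- exact: ract_linear.
rewrite ptrace_hcat_unit -(sum_pure_l f a v) (linear_sumE (ract_linear _)).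
apply: eq_bigr => q _; rewrite (linear_scaleE (ract_linear _)) ract_pure.
by rewrite comp_rconsf_lift_max rconsf_skip rconsf_max rconsf_lift_max.
Qed.

Lemma rank_op_unitary : unitary (homfr_trap V).
Proof.
exists identity_map => k l p; split=> [j|i|j|i].
- case: (unliftP ord0 j) => [a -> _|-> //]; exact: unit_hcat_lact.
- case: (unliftP ord0 i) => [a -> _|-> //]; exact: unit_hcat_ract.
- case: (unliftP ord_max j) => [a ->|->]; last by rewrite ltnn.
  by rewrite lift_max => _; apply: hcat_unit_lact.
case: (unliftP ord_max i) => [a ->|->]; last by rewrite ltnn.
by rewrite lift_max => _; apply: hcat_unit_ract.
Qed.
End UnitaryIf.

Theorem proposition2p1p2 (K : fieldType) (V : lmodType K) :
  is_trap (homfr_trap V) /\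
  (unitary (homfr_trap V) <-> finite_dimensional V).
Proof.
split; first exact: homfr_is_trap.
split; first exact: unitary_finite_dimensional.
by move=> /finite_dimensional_rank_op[r rid]; apply: rank_op_unitary rid.
Qed.
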